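(* Let $\mathbf X=(X_1,\dots,X_p)$ be a random vector of real features and $Y\in\{1,\dots,K\}$ a class label, and let $(\mathbf X_i,Y_i)$, $i=1,\dots,n$, be i.i.d. copies of $(\mathbf X,Y)$. For $1\le j,l\le p$ define the Kendall Interaction Filter (KIF) score $$w_{j,l}=\sum_{k=1}^K\pi_k\,|\tau_k(X_j,X_l)-\tau(X_j,X_l)|$$ and its empirical version $$\hat w_{j,l}=\sum_{k=1}^K\hat\pi_k\,|\hat\tau_k(X_j,X_l)-\hat\tau(X_j,X_l)|,$$ with all quantities as defined in the context. Let $\mathbf S\subseteq\{1,\dots,p\}^2$ be the set of relevant couples, $|\mathbf S|=s$, and for constants $c>0$, $r\ge0$ let $\hat{\mathbf S}=\{(j,l):\hat w_{j,l}>cn^{-r}\}$. Assume: (C1) there exist positive constants $c_1,c_2$ with $c_1/K\le\min_k\pi_k\le\max_k\pi_k\le c_2/K$; (C2) there exist constants $c>0$ and $0\le r<1/2$ with $\min_{(j,l)\in\mathbf S}w_{j,l}>2cn^{-r}$; (C3) $K=O(n^d)$ for some $0\le d<\tfrac12-r$; (C4) $\log(p)=o(n^{1-2(r+d)})$. Then there exists a positive constant $b$, depending on $c,c_1,c_2$, such that (i) $\mathbb{P}\big(\max_{1\le j,l\le p}|\hat w_{j,l}-w_{j,l}|\le cn^{-r}\big)\ge 1-O\Big(p^2n^d\exp\big(-c^2n^{1-2(r+d)}/(72b^2)\big)\Big)$; (ii) $\mathbb{P}\big(\mathbf S\subseteq\hat{\mathbf S}\big)\ge 1-O\Big(s\,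n^d\exp\big(-c^2n^{1-2(r+d)}/(72b^2)\big)\Big)$.
   Context: Let $(\tilde{\mathbf X},\tilde Y)$ be an independent copy of $(\mathbf X,Y)$. Kendall's $\tau$: $\tau(X_j,X_l)=2\mathbb{P}((X_j-\tilde X_j)(X_l-\tilde X_l)>0)-1$. Conditional Kendall's $\tau$: $\tau_k(X_j,X_l)=2\mathbb{P}((X_j-\tilde X_j)(X_l-\tilde X_l)>0\mid Y=k,\tilde Y=k)-1$. $\pi_k=\mathbb{P}(Y=k)$. Empirical versions: $n_k=\sum_i\mathbf 1\{Y_i=k\}$, $\hat\pi_k=n_k/n$, $\hat\tau(X_j,X_l)=\frac{4}{n(n-1)}\sum_{1\le i<t\le n}\mathbf 1\{(X_{ij}-X_{tj})(X_{il}-X_{tl})>0\}-1$, $\hat\tau_k(X_j,X_l)=\frac{4}{n_k(n_k-1)}\sum_{1\le i<t\le n}\mathbf 1\{(X_{ij}-X_{tj})(X_{il}-X_{tl})>0,Y_i=k,Y_t=k\}-1$. The set $\mathbf S$ of relevant couples is the set of pairs $(j,l)$ such that the conditional distribution $F(Y\mid\mathbf X)$ functionally depends on the rank association of the couple $(X_j,X_l)$; it is assumed sparse ($s$ much smaller than $p$). The asymptotics are as $n\to\infty$, with $p$, $K$ allowed to depend on $n$. *)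

(* Defs.v *)
From HB Require Import structures.
From mathcomp Require Import all_boot all_order all_algebra.
From mathcomp Require Import all_classical all_reals all_analysis.
Set Implicit Arguments. Unset Strict Implicit. Unset Printing Implicit Defensive.
Import Order.TTheory GRing.Theory Num.Theory.
Import numFieldNormedType.Exports.
Local Open Scope classical_set_scope.
Local Open Scope ring_scope.

Section KIF.
Context {R : realType} {dT : measure_display} {T : measurableType dT}.
Implicit Types (P : probability T R).

Definition rect_event (p K : nat) (Xv : 'I_p -> T -> R) (Yv : T -> 'I_K)
  (A : 'I_p -> set R) (C : {set 'I_K}) : set T :=
  [set w | (forall j, A j (Xv j w)) /\ Yv w \in C].

Definition rv_pair (p K : nat) (Xv : 'I_p -> T -> R) (Yv : T -> 'I_K) : Prop :=
  (forall j, measurable_fun setT (Xv j)) /\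
  (forall k, measurable [set w | Yv w = k]).

Definition same_law P (p K : nat) (X1 : 'I_p -> T -> R) (Y1 : T -> 'I_K)
  (X2 : 'I_p -> T -> R) (Y2 : T -> 'I_K) : Prop :=
  forall (A : 'I_p -> set R) (C : {set 'I_K}), (forall j, measurable (A j)) ->
    P (rect_event X1 Y1 A C) = P (rect_event X2 Y2 A C).

Definition mutually_indep P (m p K : nat) (X : 'I_m -> 'I_p -> T -> R)
  (Y : 'I_m -> T -> 'I_K) : Prop :=
  forall (J : {set 'I_m}) (A : 'I_m -> 'I_p -> set R) (C : 'I_m -> {set 'I_K}),
    (forall i j, measurable (A i j)) ->
    P (\bigcap_(i in [set i | i \in J]) rect_event (X i) (Y i) (A i) (C i)) =
    (\prod_(i in J) P (rect_event (X i) (Y i) (A i) (C i)))%E.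

Definition indep_copies P (p K : nat) (X0 : 'I_p -> T -> R) (Y0 : T -> 'I_K)
  (X1 : 'I_p -> T -> R) (Y1 : T -> 'I_K) : Prop :=
  rv_pair X0 Y0 /\ rv_pair X1 Y1 /\ same_law P X0 Y0 X1 Y1 /\
  forall (A A' : 'I_p -> set R) (C C' : {set 'I_K}),
    (forall j, measurable (A j)) -> (forall j, measurable (A' j)) ->
    P (rect_event X0 Y0 A C `&` rect_event X1 Y1 A' C') =
    (P (rect_event X0 Y0 A C) * P (rect_event X1 Y1 A' C'))%E.

Definition iid_sample P (n p K : nat) (X : 'I_n -> 'I_p -> T -> R)
  (Y : 'I_n -> T -> 'I_K) (X0 : 'I_p -> T -> R) (Y0 : T -> 'I_K) : Prop :=
  (forall i, rv_pair (X i) (Y i)) /\ mutually_indep P X Y /\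
  (forall i, same_law P (X i) (Y i) X0 Y0).

(* population quantities; (X0,Y0) = (X,Y) and (X1,Y1) = its independent copy *)
Definition pi_pop P (K : nat) (Y0 : T -> 'I_K) (k : 'I_K) : R :=
  fine (P [set w | Y0 w = k]).

Definition conc (a a' b b' : R) : bool := 0 < (a - a') * (b - b').

Definition tau_pop P (p : nat) (X0 X1 : 'I_p -> T -> R) (j l : 'I_p) : R :=
  2 * fine (P [set w | conc (X0 j w) (X1 j w) (X0 l w) (X1 l w)]) - 1.

Definition tau_k_pop P (p K : nat) (X0 : 'I_p -> T -> R) (Y0 : T -> 'I_K)
  (X1 : 'I_p -> T -> R) (Y1 : T -> 'I_K) (k : 'I_K) (j l : 'I_p) : R :=
  2 * (fine (P [set w | conc (X0 j w) (X1 j w) (X0 l w) (X1 l w) /\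
                         Y0 w = k /\ Y1 w = k]) /
       fine (P [set w | Y0 w = k /\ Y1 w = k])) - 1.

Definition w_pop P (p K : nat) (X0 : 'I_p -> T -> R) (Y0 : T -> 'I_K)
  (X1 : 'I_p -> T -> R) (Y1 : T -> 'I_K) (j l : 'I_p) : R :=
  \sum_(k < K) pi_pop P Y0 k *
     `|tau_k_pop P X0 Y0 X1 Y1 k j l - tau_pop P X0 X1 j l|.

Definition n_k (n K : nat) (Y : 'I_n -> T -> 'I_K) (k : 'I_K) (w : T) : nat :=
  #|[set i | Y i w == k]|.

Definition pi_hat (n K : nat) (Y : 'I_n -> T -> 'I_K) (k : 'I_K) (w : T) : R :=
  (n_k Y k w)%:R / n%:R.

Definition tau_hat (n p : nat) (X : 'I_n -> 'I_p -> T -> R) (j l : 'I_p) (w : T) : R :=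
  4 / (n%:R * (n%:R - 1)) *
    (\sum_(i < n) \sum_(t < n | (i < t)%N)
        (conc (X i j w) (X t j w) (X i l w) (X t l w))%:R) - 1.

Definition tau_k_hat (n p K : nat) (X : 'I_n -> 'I_p -> T -> R)
  (Y : 'I_n -> T -> 'I_K) (k : 'I_K) (j l : 'I_p) (w : T) : R :=
  4 / ((n_k Y k w)%:R * ((n_k Y k w)%:R - 1)) *
    (\sum_(i < n) \sum_(t < n | (i < t)%N)
        [&& conc (X i j w) (X t j w) (X i l w) (X t l w),
            Y i w == k & Y t w == k]%:R) - 1.

Definition w_hat (n p K : nat) (X : 'I_n -> 'I_p -> T -> R)
  (Y : 'I_n -> T -> 'I_K) (j l : 'I_p) (w : T) : R :=
  \sum_(k < K) pi_hat Y k w *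
     `|tau_k_hat X Y k j l w - tau_hat X j l w|.

End KIF.

(* Main.v *)
(* Fix a couple (j, l) and replace X_j and X_l by their comparisons with finitely
   many rationals. Up to an event of arbitrarily small probability this changes
   none of the order comparisons entering the score, so it is enough to bound the
   deviation for an i.i.d. sample with values in a finite type. There
   |w^ - w| <= 2 sum_k |A_k| + sum_k |B_k| + |C| + 2K/n, where A_k is the deviation
   of the k-th class frequency, B_k and C are the centred pair sums of the k-th
   class and of the whole sample, that of the k-th class being divided by the
   random class size. These are centred (for B_k, conditionally on the classes),
   and changing one observation moves every signed sum of each of the three kinds
   by O(1/n), whatever K is: an observation belongs to a single class. McDiarmid's
   inequality for each of the 2 * 4^K choices of signs gives
   P(|w^ - w| > t) <= 2 * 4^K * exp(- n t^2 / const) with a universal constant.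
   For t = c n^(-r) the factor 4^K is absorbed by half of the exponent, because
   K = O(n^d) with d < 1 - 2r; b is therefore an absolute constant. *)
Require Import Defs.
From HB Require Import structures.
From mathcomp Require Import all_boot all_order all_algebra.
From mathcomp Require Import all_classical all_reals all_analysis.
From mathcomp Require Import ring lra.
Import Order.TTheory GRing.Theory Num.Theory.
Import numFieldNormedType.Exports.
Local Open Scope ring_scope.
Set Implicit Arguments. Unset Strict Implicit. Unset Printing Implicit Defensive.

(** * McDiarmid's inequality on finite product spaces *)

(** The linear term is kept outside the exponential so that it vanishes on averaging a centred
    variable. For [x > 1/2] one has [x <= 2 x^2], which is enough. *)
Lemma expR_le_addr_sqr (R : realType) (x : R) : expR x <= x + expR (2 * x ^+ 2).
Proof.
have [x_le|x_gt] := leP x (1 / 2).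
  have h1 : 1 + 2 * x ^+ 2 <= expR (2 * x ^+ 2) by exact: expR_ge1Dx.
  have h2 : 1 - x <= expR (- x) by exact: expR_ge1Dx.
  have e0 : 0 < expR x by exact: expR_gt0.
  have h3 : expR x * (1 - x) <= 1.
    by rewrite -[leRHS](expRxMexpNx_1 x) ler_pM2l.
  (* On this range [(1 - x) (1 + x + 2 x^2) = 1 + x^2 (1 - 2 x) >= 1]. *)
  suff : expR x <= 1 + x + 2 * x ^+ 2 by lra.
  rewrite -(ler_pM2r (_ : 0 < 1 - x)); last by lra.
  apply: (le_trans h3); have := sqr_ge0 x; nra.
apply: (@le_trans _ _ (expR (2 * x ^+ 2))); last by lra.
by rewrite ler_expR; nra.
Qed.

Section FiniteProduct.
Context {R : realType} {I Z : finType}.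
Variable mu : Z -> R.
Hypothesis mu_ge0 : forall u, 0 <= mu u.
Hypothesis mu_sum1 : \sum_u mu u = 1.

Implicit Types (z : {ffun I -> Z}) (f g : {ffun I -> Z} -> R).

Definition Ex (f : {ffun I -> Z} -> R) : R :=
  \sum_(z : {ffun I -> Z}) (\prod_i mu (z i)) * f z.

Definition upd (z : {ffun I -> Z}) (i : I) (u : Z) : {ffun I -> Z} :=
  [ffun m => if m == i then u else z m].

(** Conditional expectation given the coordinates other than [i], kept as a function of all
    coordinates so that it can be iterated. *)
Definition resample (i : I) (f : {ffun I -> Z} -> R) : {ffun I -> Z} -> R :=
  fun z => \sum_u mu u * f (upd z i u).

Lemma updE z i u m : upd z i u m = if m == i then u else z m.
Proof. by rewrite ffunE. Qed.

Lemma upd_eq z i u : upd z i u i = u.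
Proof. by rewrite updE eqxx. Qed.

Lemma upd_ne z i u m : m != i -> upd z i u m = z m.
Proof. by rewrite updE => /negPf ->. Qed.

Lemma updK z i u : upd (upd z i u) i (z i) = z.
Proof. by apply/ffunP => m; rewrite !updE; case: eqP => [->|]. Qed.

Lemma upd_upd z i u v : upd (upd z i u) i v = upd z i v.
Proof. by apply/ffunP => m; rewrite !updE; case: eqP. Qed.

Lemma updC z i t u v : i != t -> upd (upd z i u) t v = upd (upd z t v) i u.
Proof.
move=> it; apply/ffunP => m; rewrite !updE.
by case: (eqVneq m t) => [->|//]; rewrite eq_sym (negPf it).
Qed.

(** Cross-multiplied because [mu (z i)] may be 0. *)
Lemma weight_upd z i u :
  mu (z i) * \prod_m mu (upd z i u m) = mu u * \prod_m mu (z m).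
Proof.
rewrite (bigD1 i)//= [in RHS](bigD1 i)//= upd_eq mulrCA; congr (_ * (_ * _)).
by apply: eq_bigr => m mi; rewrite upd_ne.
Qed.

(** Tower property: exchanging [z i] with the fresh value [u] is an involution that preserves the
    joint weight. *)
Lemma Ex_resample i f : Ex (resample i f) = Ex f.
Proof.
rewrite /Ex /resample.
under eq_bigr do rewrite mulr_sumr.
rewrite pair_bigA /=.
rewrite (reindex_onto (fun p => (upd p.1 i p.2, p.1 i))
                      (fun p => (upd p.1 i p.2, p.1 i))) /=; last first.
  by move=> [z u] _ /=; rewrite updK upd_eq.
rewrite (eq_bigl xpredT); last first.
  by move=> [z u] /=; rewrite updK upd_eq eqxx.
transitivity (\sum_(p : {ffun I -> Z} * Z)
    mu p.2 * ((\prod_m mu (p.1 m)) * f p.1)).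
  apply: eq_bigr => -[z u] _ /=.
  by rewrite updK !mulrA [X in X * _ = _]mulrC weight_upd.
rewrite -(pair_bigA _ (fun z u => mu u * ((\prod_m mu (z m)) * f z))) /=.
by apply: eq_bigr => z _; rewrite -mulr_suml mu_sum1 mul1r.
Qed.

Lemma weight_ge0 (z : {ffun I -> Z}) : 0 <= \prod_i mu (z i).
Proof. by apply: prodr_ge0. Qed.

Lemma Ex_le f g : (forall z, f z <= g z) -> Ex f <= Ex g.
Proof.
by move=> fg; apply: ler_sum => z _; apply: ler_wpM2l => //; exact: weight_ge0.
Qed.

Lemma Ex_cst a : Ex (fun=> a) = a.
Proof.
rewrite /Ex -mulr_suml -(bigA_distr_bigA (fun=> mu)) /=.
by rewrite (eq_bigr (fun=> 1)) ?big1_eq ?mul1r// => i _.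
Qed.

Lemma ExZ a f : Ex (fun z => a * f z) = a * Ex f.
Proof. by rewrite /Ex mulr_sumr; apply: eq_bigr => z _; rewrite mulrCA. Qed.

Lemma Ex_sum (J : finType) (Q : pred J) (F : J -> {ffun I -> Z} -> R) :
  Ex (fun z => \sum_(j | Q j) F j z) = \sum_(j | Q j) Ex (F j).
Proof.
by rewrite /Ex exchange_big /=; apply: eq_bigr => z _; rewrite mulr_sumr.
Qed.

Lemma ExD f g : Ex (fun z => f z + g z) = Ex f + Ex g.
Proof.
by rewrite /Ex -big_split /=; apply: eq_bigr => z _; rewrite mulrDr.
Qed.

(** Hoeffding's lemma with a weaker constant: the linear term of [expR_le_addr_sqr] averages to
    0. *)
Lemma mgf_centered (X : Z -> R) a : \sum_u mu u * X u = 0 ->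
  (forall u, `|X u| <= a) -> \sum_u mu u * expR (X u) <= expR (2 * a ^+ 2).
Proof.
move=> X0 Xa.
apply: (@le_trans _ _ (\sum_u mu u * (X u + expR (2 * a ^+ 2)))).
  apply: ler_sum => u _; apply: ler_wpM2l => //.
  apply: (le_trans (expR_le_addr_sqr _)).
  rewrite lerD2l ler_expR ler_pM2l// -(real_normK (num_real (X u))).
  by rewrite lerXn2r ?nnegrE// (le_trans _ (Xa u)).
under eq_bigr do rewrite mulrDr.
by rewrite big_split /= X0 add0r -mulr_suml mu_sum1 mul1r.
Qed.

Definition bounded_diff (a : R) (f : {ffun I -> Z} -> R) :=
  forall z i u, `|f (upd z i u) - f z| <= a.

Lemma resample_sub z i f y :
  resample i f z - y = \sum_u mu u * (f (upd z i u) - y).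
Proof.
under [RHS]eq_bigr do rewrite mulrBr.
by rewrite sumrB -mulr_suml mu_sum1 mul1r.
Qed.

Lemma resample_bounded_diff i a f :
  bounded_diff a f -> bounded_diff a (resample i f).
Proof.
move=> fa z m v; rewrite resample_sub.
rewrite /resample.
have a0 : 0 <= a by apply: le_trans (fa z i v).
case: (eqVneq m i) => [->|mi].
  under eq_bigr do rewrite upd_upd mulrBr.
  by rewrite sumrB -mulr_suml mu_sum1 mul1r subrr normr0.
rewrite (_ : \sum_u _ = \sum_u mu u * (f (upd (upd z i u) m v) - f (upd z i u))).
  apply: le_trans (ler_norm_sum _ _ _) _.
  rewrite -[leRHS]mul1r -mu_sum1 mulr_suml; apply: ler_sum => u _.
  by rewrite normrM ger0_norm// ler_wpM2l.
under eq_bigr do rewrite mulrBr.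
under [RHS]eq_bigr do rewrite mulrBr.
rewrite !sumrB -mulr_suml mu_sum1 mul1r; congr (_ - _).
by apply: eq_bigr => u _; rewrite updC.
Qed.

(** Given the other coordinates, [f - resample i f] is centred and, as an average of differences, at
    most [a] in absolute value; [mgf_centered] bounds its conditional exponential moment. *)
Lemma mgf_resample i a f : bounded_diff a f ->
  Ex (fun z => expR (f z)) <=
  expR (2 * a ^+ 2) * Ex (fun z => expR (resample i f z)).
Proof.
move=> fa; rewrite -(Ex_resample i) -ExZ; apply: Ex_le => z.
rewrite /resample -/(resample i f z).
rewrite (eq_bigr (fun u => expR (resample i f z) *
  (mu u * expR (f (upd z i u) - resample i f z)))); last first.
  by move=> u _; rewrite mulrCA -expRD subrKC.
rewrite -mulr_sumr mulrC ler_wpM2r ?expR_ge0//.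
apply: mgf_centered.
  by rewrite -resample_sub subrr.
move=> u; rewrite distrC resample_sub.
apply: le_trans (ler_norm_sum _ _ _) _.
rewrite -[leRHS]mul1r -mu_sum1 mulr_suml; apply: ler_sum => v _.
rewrite normrM ger0_norm// ler_wpM2l//.
by rewrite -(upd_upd z i u v).
Qed.

(* McDiarmid's martingale argument: averaging out the coordinates one at a
   time costs a factor [expR (2 * a ^+ 2)] each and ends with a constant. *)
Lemma mcdiarmid a f : bounded_diff a f -> Ex f = 0 ->
  Ex (fun z => expR (f z)) <= expR (2 * a ^+ 2 * #|I|%:R).
Proof.
move=> fa f0.
pose F s := foldr resample f s.
have Fa s : bounded_diff a (F s).
  by elim: s => //= i s IH; exact: resample_bounded_diff.
have ExF s : Ex (F s) = 0.
  by elim: s => //= i s IH; rewrite Ex_resample.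
have Finv (s : seq I) i z u : i \in s -> F s (upd z i u) = F s z.
  elim: s z => //= m s IH z; rewrite inE /resample.
  case: (eqVneq i m) => [-> _|im /= ims].
    by apply: eq_bigr => v _; rewrite upd_upd.
  by apply: eq_bigr => v _; rewrite updC// IH.
have mgfF s : Ex (fun z => expR (f z)) <=
    expR (2 * a ^+ 2 * (size s)%:R) * Ex (fun z => expR (F s z)).
  elim: s => [|i s IH]; first by rewrite /= mulr0 expR0 mul1r.
  apply: (le_trans IH) => /=.
  rewrite -[(size s).+1%:R]natr1 mulrDr mulr1 expRD -[leRHS]mulrA ler_wpM2l ?expR_ge0//.
  exact: mgf_resample.
have Fcst z z' : F (enum I) z = F (enum I) z'.
  (* [G s] follows [z] on [s] and [z'] elsewhere. Enlarging [s] one index at a time changes one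
     coordinate, to which [F (enum I)] is insensitive. *)
  pose G (s : seq I) : {ffun I -> Z} := [ffun m => if m \in s then z m else z' m].
  have GF s : F (enum I) (G s) = F (enum I) z'.
    elim: s => [|i s IH].
      by congr F; apply/ffunP => m; rewrite ffunE.
    rewrite -IH -(@Finv _ i (G s) (z i)) ?mem_enum//; congr F.
    by apply/ffunP => m; rewrite updE !ffunE inE; case: eqP => [->|].
  by rewrite -(GF (enum I)); congr F; apply/ffunP => m; rewrite ffunE mem_enum.
have F0 z : F (enum I) z = 0.
  rewrite -(ExF (enum I)) -[LHS]Ex_cst /Ex.
  by apply: eq_bigr => z' _; rewrite (Fcst z z').
apply: (le_trans (mgfF (enum I))); rewrite -cardE.
rewrite -[leRHS]mulr1 ler_wpM2l ?expR_ge0// -[leRHS]Ex_cst.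
by apply: Ex_le => z; rewrite F0 expR0.
Qed.

End FiniteProduct.

(** * Class frequencies and pair statistics *)

(** The square of the sum splits into [i < t], [t < i] and the diagonal; the last is the sum itself,
    the indicators being idempotent. *)
Lemma sum_ordered_pairs (R : pzRingType) n (x : 'I_n -> bool) :
  (\sum_(i < n) \sum_(t < n | (i < t)%N) (x i && x t)%:R) * 2 =
  (\sum_(i < n) (x i)%:R) * (\sum_(i < n) (x i)%:R - 1) :> R.
Proof.
have sq : (\sum_(i < n) (x i)%:R) * (\sum_(i < n) (x i)%:R) =
    \sum_(i < n) \sum_(t < n) (x i && x t)%:R :> R.
  rewrite mulr_suml; apply: eq_bigr => i _; rewrite mulr_sumr.
  by apply: eq_bigr => t _; rewrite -natrM mulnb.
rewrite mulrBr mulr1 sq [in RHS](eq_bigr (fun i : 'I_n =>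
  \sum_(t < n | (i < t)%N) (x i && x t)%:R +
  \sum_(t < n | (t < i)%N) (x i && x t)%:R + (x i)%:R)); last first.
  move=> i _; rewrite (bigID (fun t : 'I_n => (i < t)%N)) /= -addrA.
  congr (_ + _); rewrite (bigD1 i) ?ltnn//= andbb addrC; congr (_ + _).
  by apply: eq_bigl => t; rewrite -leqNgt [RHS]ltn_neqAle andbC.
rewrite !big_split /= addrK mulr2n mulrDr mulr1; congr (_ + _).
rewrite (exchange_big_dep xpredT)//=; apply: eq_bigr => i _.
by apply: eq_bigr => t _; rewrite andbC.
Qed.

Section PairStatistic.
Context {R : realType} {Z : finType} {n K : nat}.
Variables (mu : Z -> R) (y : Z -> 'I_K) (h : 'I_K -> Z -> Z -> R).
Hypothesis mu_ge0 : forall u, 0 <= mu u.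
Hypothesis mu_sum1 : \sum_u mu u = 1.
Hypothesis h_le : forall k u v, `|h k u v| <= ((y u == k) && (y v == k))%:R.
Hypothesis h_mean0 : forall k, \sum_u \sum_v mu u * (mu v * h k u v) = 0.

Implicit Types (z : {ffun 'I_n -> Z}) (D : pred 'I_n) (k : 'I_K).

(** [D] selects the observations that count: [xpredT] for the whole sample, [predC1 i] for the
    sample without observation [i]. *)
Definition class_size D k z : R := \sum_(i < n) (D i && (y (z i) == k))%:R.

Definition pair_sum D k z : R :=
  \sum_(i < n) \sum_(t < n | (i < t)%N) (D i && D t)%:R * h k (z i) (z t).

(* For class size 1 the denominator is [0], but then [pair_sum] is [0] too. *)
Definition pair_stat D k z : R :=
  4 / n%:R * (pair_sum D k z / (class_size D k z - 1)).

Lemma class_size_nat D k z : exists m : nat, class_size D k z = m%:R.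
Proof.
by exists (\sum_(i < n) (D i && (y (z i) == k)))%N; rewrite natr_sum.
Qed.

Lemma class_sizeD1 i k z :
  class_size xpredT k z = class_size (predC1 i) k z + (y (z i) == k)%:R.
Proof.
rewrite /class_size (bigD1 i)//= addrC; congr (_ + _).
rewrite [RHS](bigD1 i)//= eqxx/= add0r.
by apply: eq_bigr => m ->.
Qed.

Lemma pair_sum_le D k z :
  `|pair_sum D k z| * 2 <= class_size D k z * (class_size D k z - 1).
Proof.
rewrite -sum_ordered_pairs ler_pM2r//.
apply: le_trans (ler_norm_sum _ _ _) _; apply: ler_sum => i _.
apply: le_trans (ler_norm_sum _ _ _) _; apply: ler_sum => t _.
rewrite normrM ger0_norm//.
have := h_le k (z i) (z t).
by case: (D i); case: (D t) => //= H; rewrite ?mul1r ?mul0r// andbF.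
Qed.

(** Only the pairs containing [i] differ, and the right-hand side is twice the number of those lying
    in class [k]. *)
Lemma pair_sumB_le i k z :
  `|pair_sum xpredT k z - pair_sum (predC1 i) k z| * 2 <=
  class_size xpredT k z * (class_size xpredT k z - 1) -
  class_size (predC1 i) k z * (class_size (predC1 i) k z - 1).
Proof.
rewrite -!sum_ordered_pairs -mulrBl ler_pM2r// -!sumrB.
apply: le_trans (ler_norm_sum _ _ _) _; apply: ler_sum => a _.
rewrite -!sumrB.
apply: le_trans (ler_norm_sum _ _ _) _; apply: ler_sum => t _ /=.
rewrite -mulrBl normrM; have := h_le k (z a) (z t).
case: (a == i); case: (t == i) => /= H;
  rewrite ?subr0 ?subrr ?normr0 ?normr1 ?mul1r ?mul0r//.
by rewrite andbF subr0.
Qed.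

(** Here [m] is the class size before an observation joins, [S] its pair sum and [r] the
    contribution of the new pairs. The new pairs cost [r / m], at most 1; the change of denominator
    costs [S / (m (m - 1))], at most 1/2. *)
Lemma ratio_perturbation (m : nat) (S r : R) :
  `|S| * 2 <= m%:R * (m%:R - 1) -> `|r| <= m%:R ->
  `|(S + r) / (m%:R + 1 - 1) - S / (m%:R - 1)| <= 3 / 2.
Proof.
(* Sizes 0 and 1 are separate: a denominator is 0 there, but so is [S]. *)
case: m => [|[|m]].
- rewrite mulr0n mul0r => S0 r0.
  have -> : S = 0 by apply/eqP; rewrite -normr_le0; lra.
  have -> : r = 0 by apply/eqP; rewrite -normr_le0.
  by rewrite addr0 !mul0r subrr normr0; lra.
- rewrite !mulr1n subrr mulr0 => S0 r0.
  have -> : S = 0 by apply/eqP; rewrite -normr_le0; lra.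
  by rewrite mul0r subr0 add0r addrK divr1; apply: (le_trans r0); lra.
rewrite addrK; set M := m.+2%:R => S_le r_le.
have M2 : 2 <= M by rewrite ler_nat.
have -> : (S + r) / M - S / (M - 1) = r / M - S / (M * (M - 1)).
  by field; rewrite ?andbT; apply/andP; split; lra.
apply: le_trans (ler_normB _ _) _.
rewrite !normrM !normfV [`|M|]ger0_norm; last lra.
rewrite [`|M * _|]ger0_norm; last nra.
have -> : 3 / 2 = 1 + 1 / 2 :> R by lra.
apply: lerD; first by rewrite ler_pdivrMr ?mul1r//; lra.
by rewrite ler_pdivrMr; nra.
Qed.

(** The constant is [6 = 4 * 3/2]. The indicator confines the change to the class of observation
    [i], so that summing over [k] brings in no factor [K]. *)
Lemma pair_stat_leave_one_out i k z :
  `|pair_stat xpredT k z - pair_stat (predC1 i) k z| <=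
  (y (z i) == k)%:R * (6 / n%:R).
Proof.
rewrite /pair_stat -mulrBr normrM ger0_norm; last by rewrite divr_ge0.
rewrite (_ : _ * (6 / _) = 4 / n%:R * ((y (z i) == k)%:R * (3 / 2))); last first.
  by set a := n%:R^-1; set x := (_ == _)%:R; nra.
apply: ler_wpM2l; first by rewrite divr_ge0.
have := pair_sumB_le i k z; have := pair_sum_le (predC1 i) k z.
rewrite (class_sizeD1 i); have [m ->] := class_size_nat (predC1 i) k z.
set S := pair_sum xpredT k z; set S' := pair_sum _ k z.
case: (y (z i) == k) => /= S'_le r_le; last first.
  rewrite addr0 subrr in r_le.
  have -> : S = S'.
    by apply/eqP; rewrite -subr_eq0 -normr_le0; lra.
  by rewrite addr0 subrr normr0 mul0r.
rewrite mul1r -(subrKC S' S); apply: ratio_perturbation => //.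
(* An observation joining [m] others creates [m] pairs: [(m + 1) m - m (m - 1) = 2 m]. *)
by nra.
Qed.

(** Resampling [i] and [t] averages [g] to 0 and leaves [psi] fixed. *)
Lemma Ex_pair_mean0 (i t : 'I_n) (g : Z -> Z -> R) (psi : {ffun 'I_n -> Z} -> R) :
  i != t -> \sum_u \sum_v mu u * (mu v * g u v) = 0 ->
  (forall z u, psi (upd z i u) = psi z) ->
  (forall z u, psi (upd z t u) = psi z) ->
  Ex mu (fun z => g (z i) (z t) * psi z) = 0.
Proof.
move=> it g0 psii psit.
rewrite -(Ex_resample mu_sum1 t) -(Ex_resample mu_sum1 i).
rewrite -[RHS](Ex_cst (I := 'I_n) mu_sum1); congr Ex; apply/funext => z.
transitivity ((\sum_u \sum_v mu u * (mu v * g u v)) * psi z); last first.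
  by rewrite g0 mul0r.
rewrite /resample mulr_suml; apply: eq_bigr => u _.
rewrite mulr_sumr mulr_suml; apply: eq_bigr => v _.
by rewrite upd_ne// !upd_eq psit psii !mulrA.
Qed.

Lemma Ex_pair_stat k : Ex mu (pair_stat xpredT k) = 0.
Proof.
(* When [i] and [t] are in class [k], [psi i t z] is the inverse of the
   denominator of [pair_stat], yet it does not depend on [z i] and [z t]. *)
pose psi (i t : 'I_n) z : R :=
  (1 + \sum_(m < n | (m != i) && (m != t)) (y (z m) == k)%:R)^-1.
have -> : pair_stat xpredT k = fun z => 4 / n%:R *
    \sum_(i < n) \sum_(t < n | (i < t)%N) h k (z i) (z t) * psi i t z.
  apply/funext => z; rewrite /pair_stat; congr (_ * _).
  rewrite /pair_sum mulr_suml; apply: eq_bigr => i _.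
  rewrite mulr_suml; apply: eq_bigr => t it; rewrite mul1r.
  have [/andP[yi yt]|ykN] := boolP ((y (z i) == k) && (y (z t) == k)); last first.
    have -> : h k (z i) (z t) = 0.
      apply/eqP; rewrite -normr_le0; apply: le_trans (h_le _ _ _) _.
      by rewrite (negPf ykN).
    by rewrite !mul0r.
  congr (_ * _); rewrite /psi /class_size (bigD1 i)//= (bigD1 t)/=.
    by rewrite yi yt /= [X in X^-1]addrC addKr.
  by rewrite neq_ltn it orbT.
rewrite ExZ Ex_sum big1 ?mulr0// => i _; rewrite Ex_sum big1// => t it.
apply: Ex_pair_mean0 => //; first by rewrite neq_ltn it.
- move=> z u; rewrite /psi; congr (_ + _)^-1; apply: eq_bigr => m /andP[mi mt].
  by rewrite upd_ne.
- move=> z u; rewrite /psi; congr (_ + _)^-1; apply: eq_bigr => m /andP[mi mt].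
  by rewrite upd_ne.
Qed.

Lemma class_size_upd i k z u :
  class_size (predC1 i) k (upd z i u) = class_size (predC1 i) k z.
Proof.
apply: eq_bigr => m _ /=; case: (eqVneq m i) => //= mi; by rewrite upd_ne.
Qed.

Lemma pair_stat_upd i k z u :
  pair_stat (predC1 i) k (upd z i u) = pair_stat (predC1 i) k z.
Proof.
rewrite /pair_stat class_size_upd; congr (_ * (_ / _)).
apply: eq_bigr => a _; apply: eq_bigr => t _ /=.
case: (eqVneq a i) => ai; rewrite ?mul0r//=.
by case: (eqVneq t i) => ti; rewrite ?mul0r// !upd_ne.
Qed.

(** With fixed signs the sum is linear in [F], hence centred when each [F k] is, which a sum of
    absolute values would not be. *)
Definition signed_sum (F : 'I_K -> {ffun 'I_n -> Z} -> R)
  (s : {ffun 'I_K -> bool}) z : R := \sum_k (-1) ^+ s k * F k z.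

(** [G i] is [F] with observation [i] left out; the two differ in the class of [z i] only. Going
    through [G i] before and after the update costs [a] twice. *)
Lemma signed_sum_bounded_diff (F : 'I_K -> {ffun 'I_n -> Z} -> R)
    (G : 'I_n -> 'I_K -> {ffun 'I_n -> Z} -> R) a s :
  (forall i k z, `|F k z - G i k z| <= (y (z i) == k)%:R * a) ->
  (forall i k z u, G i k (upd z i u) = G i k z) ->
  bounded_diff (2 * a) (signed_sum F s).
Proof.
move=> FG GE.
have FGs i z : `|signed_sum F s z - signed_sum (G i) s z| <= a.
  rewrite /signed_sum -sumrB; apply: le_trans (ler_norm_sum _ _ _) _.
  rewrite [leRHS](_ : _ = \sum_k (y (z i) == k)%:R * a); last first.
    rewrite (bigD1 (y (z i)))//= eqxx mul1r big1 ?addr0// => k.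
    by rewrite eq_sym => /negPf ->; rewrite mul0r.
  by apply: ler_sum => k _; rewrite -mulrBr normrMsign.
move=> z i u.
have GEs : signed_sum (G i) s (upd z i u) = signed_sum (G i) s z.
  by apply: eq_bigr => k _; rewrite GE.
have := FGs i (upd z i u); rewrite GEs => h1; have := FGs i z.
rewrite distrC => h2.
have := ler_normD (signed_sum F s (upd z i u) - signed_sum (G i) s z)
  (signed_sum (G i) s z - signed_sum F s z).
rewrite addrA subrK; lra.
Qed.

Lemma Ex_signed_sum F s : (forall k, Ex mu (F k) = 0) ->
  Ex mu (signed_sum F s) = 0.
Proof.
by move=> F0; rewrite /signed_sum Ex_sum big1// => k _; rewrite ExZ F0 mulr0.
Qed.

Lemma sum_norm_signed F z :
  exists s, \sum_k `|F k z| = signed_sum F s z.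
Proof.
exists [ffun k => F k z < 0]; apply: eq_bigr => k _.
by rewrite ffunE -{1}[F k z]mulr_sign_norm normrMsign normr_id normrEsign.
Qed.

Definition class_dev k z : R :=
  class_size xpredT k z / n%:R - \sum_(u | y u == k) mu u.

(* [pair_stat] and [class_dev] are compared with their versions without the
   observation [i], which are insensitive to it. *)
Definition class_dev_loo (i : 'I_n) k z : R :=
  class_size (predC1 i) k z / n%:R - \sum_(u | y u == k) mu u.

Lemma class_dev_leave_one_out i k z :
  `|class_dev k z - class_dev_loo i k z| <= (y (z i) == k)%:R * (1 / n%:R).
Proof.
rewrite /class_dev /class_dev_loo (class_sizeD1 i) [leLHS](_ : _ =
  `|(y (z i) == k)%:R * (1 / n%:R)|); last by congr (`|_|); ring.
by rewrite ger0_norm// mulr_ge0.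
Qed.

Lemma Ex_class_dev k : (0 < n)%N -> Ex mu (class_dev k) = 0.
Proof.
move=> n0; rewrite /class_dev ExD Ex_cst//.
rewrite (_ : (fun z => _) = fun z => n%:R^-1 * class_size xpredT k z); last first.
  by apply/funext => z; rewrite mulrC.
rewrite ExZ /class_size Ex_sum (eq_bigr (fun=> \sum_(u | y u == k) mu u)).
  rewrite big_const_ord iter_addr_0 -[X in _ * X]mulr_natl mulrA mulVf ?mul1r ?subrr//.
  by rewrite pnatr_eq0 -lt0n.
move=> i _; rewrite -(Ex_resample mu_sum1 i) -[RHS](Ex_cst (I := 'I_n) mu_sum1).
congr Ex; apply/funext => z; rewrite /resample [RHS]big_mkcond /=.
by apply: eq_bigr => u _; rewrite upd_eq; case: eqP; rewrite ?mulr1 ?mulr0.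
Qed.

End PairStatistic.

(** * Deviation of the score for observations in a finite type *)

Lemma bounded_diffD (R : realType) (I Z : finType) (a b : R)
    (f g : {ffun I -> Z} -> R) : bounded_diff a f -> bounded_diff b g ->
  bounded_diff (a + b) (fun z => f z + g z).
Proof.
move=> fa gb z i u; rewrite opprD addrACA.
by apply: le_trans (ler_normD _ _) _; apply: lerD.
Qed.

Lemma bounded_diffZ (R : realType) (I Z : finType) (a b : R)
    (f : {ffun I -> Z} -> R) : 0 <= b -> bounded_diff a f ->
  bounded_diff (b * a) (fun z => b * f z).
Proof.
by move=> b0 fa z i u; rewrite -mulrBr normrM ger0_norm// ler_wpM2l.
Qed.

(** Primes mark estimates. The errors of the coefficients keep the estimated weight [p'], which
    cancels one class size in the normalisation of [tau_k_hat] and leaves that of [pair_stat]. *)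
Lemma weighted_distB_le (R : realFieldType) (p' p a' a b' b : R) : 0 <= p' ->
  `|a - b| <= 2 -> `|p' * `|a' - b'| - p * `|a - b| | <=
  2 * `|p' - p| + p' * `|a' - a| + p' * `|b' - b|.
Proof.
move=> p'0 ab.
have -> : p' * `|a' - b'| - p * `|a - b| =
  (p' - p) * `|a - b| + p' * (`|a' - b'| - `|a - b|) by ring.
have h : `| `|a' - b'| - `|a - b| | <= `|a' - a| + `|b' - b|.
  apply: le_trans (ler_dist_dist _ _) _.
  by rewrite (_ : a' - b' - (a - b) = (a' - a) - (b' - b)) ?ler_normB//; ring.
apply: le_trans (ler_normD _ _) _; rewrite -addrA -mulrDr; apply: lerD.
  by rewrite normrM normr_id mulrC ler_wpM2r.
by rewrite normrM (ger0_norm p'0) ler_wpM2l.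
Qed.

Section Scores.
Context {R : realType}.

(** The empirical score as a function of the concordance table and the labels alone, so that it
    applies both to the real sample and to its discretisation. *)
Definition kif_score n K (C : 'I_n -> 'I_n -> bool) (y : 'I_n -> 'I_K) : R :=
  \sum_(k < K) (#|[set i | y i == k]|%:R / n%:R) *
    `|(4 / (#|[set i | y i == k]|%:R * (#|[set i | y i == k]|%:R - 1)) *
        (\sum_(i < n) \sum_(t < n | (i < t)%N)
           [&& C i t, y i == k & y t == k]%:R) - 1) -
      (4 / (n%:R * (n%:R - 1)) *
        (\sum_(i < n) \sum_(t < n | (i < t)%N) (C i t)%:R) - 1)|.

Definition kif_pop K (pi q : 'I_K -> R) (q0 : R) : R :=
  \sum_(k < K) pi k * `|(2 * q k - 1) - (2 * q0 - 1)|.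

End Scores.

Section FiniteTail.
Context {R : realType} {Z : finType} {n K : nat}.
Variables (mu : Z -> R) (y : Z -> 'I_K) (g : Z -> Z -> bool).
Hypothesis mu_ge0 : forall u, 0 <= mu u.
Hypothesis mu_sum1 : \sum_u mu u = 1.

Definition class_prob k : R := \sum_(u | y u == k) mu u.
Definition pair_prob : R := \sum_u \sum_v mu u * mu v * (g u v)%:R.
Definition class_pair_prob k : R :=
  \sum_u \sum_v mu u * mu v * [&& g u v, y u == k & y v == k]%:R.
Definition cond_pair_prob k : R := class_pair_prob k / class_prob k ^+ 2.

Definition class_kernel k u v : R :=
  ((y u == k) && (y v == k))%:R * ((g u v)%:R - cond_pair_prob k).
(** Puts the whole sample in a single class, so that the results on [pair_stat] also cover the
    unconditional coefficient. *)
Definition one_class (u : Z) : 'I_1 := ord0.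
Definition kernel (k : 'I_1) u v : R := (g u v)%:R - pair_prob.

Lemma class_prob_ge0 k : 0 <= class_prob k.
Proof. by apply: sumr_ge0. Qed.

Lemma sqr_class_probE k :
  class_prob k ^+ 2 = \sum_u \sum_v mu u * mu v * ((y u == k) && (y v == k))%:R.
Proof.
rewrite expr2 /class_prob big_mkcond mulr_suml; apply: eq_bigr => u _ /=.
rewrite mulr_sumr; apply: eq_bigr => v _.
by do 2 case: (_ == k); rewrite /= ?mulr0 ?mul0r ?mulr1.
Qed.

Lemma class_pair_prob_ge0 k : 0 <= class_pair_prob k.
Proof. by do 2 (apply: sumr_ge0 => ? _); rewrite !mulr_ge0. Qed.

Lemma class_pair_prob_le k : class_pair_prob k <= class_prob k ^+ 2.
Proof.
rewrite sqr_class_probE; apply: ler_sum => u _; apply: ler_sum => v _.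
rewrite ler_wpM2l ?mulr_ge0// ler_nat.
by case: (g u v).
Qed.

Lemma cond_pair_prob_itv k : 0 <= cond_pair_prob k <= 1.
Proof.
rewrite divr_ge0 ?class_pair_prob_ge0 ?sqr_ge0//=.
have [p0|p0] := eqVneq (class_prob k) 0.
  by rewrite /cond_pair_prob p0 expr0n invr0 mulr0.
by rewrite ler_pdivrMr ?mul1r ?class_pair_prob_le// exprn_even_gt0.
Qed.

Lemma pair_mass1 : \sum_u \sum_v mu u * mu v = 1.
Proof.
rewrite -[RHS]mu_sum1.
by apply: eq_bigr => u _; rewrite -mulr_sumr mu_sum1 mulr1.
Qed.

Lemma pair_prob_itv : 0 <= pair_prob <= 1.
Proof.
apply/andP; split; first by do 2 (apply: sumr_ge0 => ? _); rewrite !mulr_ge0.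
rewrite -[leRHS]pair_mass1; apply: ler_sum => u _; apply: ler_sum => v _.
by rewrite -[leRHS]mulr1 ler_wpM2l ?mulr_ge0// lern1 leq_b1.
Qed.

Lemma indicatorB_le (b : bool) (q : R) : 0 <= q <= 1 -> `|b%:R - q| <= 1.
Proof. by move=> /andP[q0 q1]; rewrite ler_norml; case: b => /=; lra. Qed.

Lemma class_kernel_le k u v :
  `|class_kernel k u v| <= ((y u == k) && (y v == k))%:R.
Proof.
rewrite normrM ger0_norm// -[leRHS]mulr1 ler_wpM2l//.
exact/indicatorB_le/cond_pair_prob_itv.
Qed.

Lemma kernel_le k u v :
  `|kernel k u v| <= ((one_class u == k) && (one_class v == k))%:R.
Proof. by rewrite ord1 !eqxx; exact/indicatorB_le/pair_prob_itv. Qed.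

Lemma class_kernel_mean0 k :
  \sum_u \sum_v mu u * (mu v * class_kernel k u v) = 0.
Proof.
transitivity (class_pair_prob k - cond_pair_prob k * class_prob k ^+ 2).
  rewrite sqr_class_probE mulr_sumr -sumrB; apply: eq_bigr => u _.
  rewrite mulr_sumr -sumrB; apply: eq_bigr => v _.
  rewrite /class_kernel; case: (g u v); case: (_ && _) => /=; ring.
have [p0|p0] := eqVneq (class_prob k) 0.
  rewrite p0 expr0n mulr0 subr0.
  have := class_pair_prob_le k; have := class_pair_prob_ge0 k.
  by rewrite p0 expr0n /=; lra.
by rewrite /cond_pair_prob divfK ?subrr// expf_neq0.
Qed.

Lemma kernel_mean0 k : \sum_u \sum_v mu u * (mu v * kernel k u v) = 0.
Proof.
transitivity (pair_prob - pair_prob * 1); last by rewrite mulr1 subrr.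
rewrite -pair_mass1 mulr_sumr -sumrB; apply: eq_bigr => u _.
rewrite mulr_sumr -sumrB; apply: eq_bigr => v _.
by rewrite /kernel; ring.
Qed.

Implicit Types (z : {ffun 'I_n -> Z}).

Local Notation A := (class_dev mu y).
Local Notation B := (pair_stat y class_kernel xpredT).
Local Notation C := (pair_stat one_class kernel xpredT).
Local Notation N k z := (class_size y xpredT k z : R).
Local Notation Tk k z := (\sum_(i < n) \sum_(t < n | (i < t)%N)
  [&& g (z i) (z t), y (z i) == k & y (z t) == k]%:R : R).
Local Notation T0 z := (\sum_(i < n) \sum_(t < n | (i < t)%N)
  (g (z i) (z t))%:R : R).

Lemma class_pair_sum k z :
  pair_sum class_kernel xpredT k z * 2 =
  Tk k z * 2 - cond_pair_prob k * (N k z * (N k z - 1)).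
Proof.
rewrite /class_size -sum_ordered_pairs mulrA -mulrBl; congr (_ * _).
rewrite mulr_sumr -sumrB; apply: eq_bigr => i _.
rewrite mulr_sumr -sumrB; apply: eq_bigr => t _; rewrite /= mul1r /class_kernel.
case: (g _ _); case: (_ && _) => /=; ring.
Qed.

Lemma one_class_size k z : class_size one_class xpredT k z = n%:R :> R.
Proof.
rewrite /class_size (eq_bigr (fun=> 1)) ?sumr_const ?card_ord// => i _.
by rewrite (ord1 k) (_ : one_class _ == ord0).
Qed.

Lemma one_class_pair_sum k z :
  pair_sum kernel xpredT k z * 2 =
  T0 z * 2 - pair_prob * (n%:R * (n%:R - 1)).
Proof.
rewrite -(one_class_size k z) /class_size -sum_ordered_pairs mulrA -mulrBl.
congr (_ * _); rewrite mulr_sumr -sumrB; apply: eq_bigr => i _.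
rewrite mulr_sumr -sumrB; apply: eq_bigr => t _; rewrite /= mul1r /kernel.
by rewrite (ord1 k) mulr1.
Qed.

Lemma tau_devE z : (1 < n)%N ->
  (4 / (n%:R * (n%:R - 1)) * T0 z - 1) - (2 * pair_prob - 1) = C ord0 z.
Proof.
move=> n1; have n1' : 2 <= n%:R :> R by rewrite ler_nat.
rewrite /pair_stat one_class_size.
have -> : pair_sum kernel xpredT ord0 z =
    T0 z - pair_prob * (n%:R * (n%:R - 1)) / 2.
  by have := one_class_pair_sum ord0 z; lra.
by field; rewrite ?andbT; apply/andP; split; lra.
Qed.

Lemma class_tau_dev_le k z : (1 < n)%N ->
  N k z / n%:R * `|(4 / (N k z * (N k z - 1)) * Tk k z - 1) -
                   (2 * cond_pair_prob k - 1)| <= `|B k z| + 2 / n%:R.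
Proof.
move=> n1; have n1' : 2 <= n%:R :> R by rewrite ler_nat.
have ninv : 0 < n%:R^-1 :> R by rewrite invr_gt0; lra.
rewrite /pair_stat.
have -> : pair_sum class_kernel xpredT k z =
    Tk k z - cond_pair_prob k * (N k z * (N k z - 1)) / 2.
  by have := class_pair_sum k z; lra.
have [m ->] := @class_size_nat R _ _ _ y xpredT k z.
have /andP[q0 q1] := cond_pair_prob_itv k.
(* Class sizes 0 and 1: division by 0 makes the empirical coefficient -1, its error is at most 2 and
   its weight at most [1 / n]. *)
have small (x : R) : 0 <= x <= 1 -> x * (x - 1) = 0 ->
  x / n%:R * `|4 / (x * (x - 1)) * Tk k z - 1 - (2 * cond_pair_prob k - 1)|
    <= 2 / n%:R.
  move=> /andP[x0 x1] ->; rewrite invr0 mulr0 mul0r.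
  rewrite mulrAC ler_wpM2r ?(ltW ninv)//.
  rewrite (_ : 0 - 1 - _ = - (2 * cond_pair_prob k)); last by ring.
  rewrite normrN ger0_norm; last by rewrite mulr_ge0.
  have : 0 <= x * (1 - cond_pair_prob k) by rewrite mulr_ge0// subr_ge0.
  by lra.
case: m => [|[|m]].
- apply: (le_trans (small _ _ _)); rewrite ?mul0r ?lexx ?ler01//.
  by rewrite lerDr.
- apply: (le_trans (small _ _ _)); rewrite ?subrr ?mulr0 ?lexx ?ler01//.
  by rewrite lerDr.
set M := m.+2%:R; have M2 : 2 <= M :> R by rewrite ler_nat.
apply: ler_wpDr; first by rewrite mulr_ge0// ltW.
rewrite -{1}(ger0_norm (_ : 0 <= M / n%:R)); last by apply: mulr_ge0; lra.
rewrite -normrM le_eqVlt; apply/orP; left; apply/eqP; congr (`|_|).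
by field; rewrite ?andbT; apply/and3P; split; lra.
Qed.

Lemma score_dev_le z : (1 < n)%N ->
  `|kif_score (fun i t => g (z i) (z t)) (fun i => y (z i)) -
    kif_pop class_prob cond_pair_prob pair_prob| <=
  2 * (\sum_k `|A k z|) + (\sum_k `|B k z|) + (\sum_k `|C k z|) +
  2 * K%:R / n%:R.
Proof.
move=> n1; have n1' : 2 <= n%:R :> R by rewrite ler_nat.
have NE k : #|[set i | y (z i) == k]|%:R = N k z.
  rewrite /class_size -natr_sum -sum1_card; congr (_ %:R).
  rewrite big_mkcond /=; apply: eq_bigr => i _.
  by rewrite inE; case: (_ == _).
(* The class frequencies add up to 1, so the single deviation [C] can be distributed over the
   classes. *)
have -> : \sum_k `|C k z| = \sum_k (N k z / n%:R) * `|C ord0 z|.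
  rewrite big_ord1 -mulr_suml -mulr_suml /class_size exchange_big /=.
  rewrite (eq_bigr (fun=> 1)) => [|i _]; last first.
    by rewrite (bigD1 (y (z i)))//= eqxx big1 ?addr0// => k; rewrite eq_sym => /negPf ->.
  by rewrite sumr_const card_ord mulfV ?mul1r//; lra.
rewrite (_ : 2 * K%:R / _ = \sum_(k < K) 2 / n%:R); last first.
  by rewrite sumr_const card_ord -[RHS]mulr_natr mulrAC.
rewrite mulr_sumr -!big_split /= /kif_score /kif_pop -sumrB.
apply: le_trans (ler_norm_sum _ _ _) _; apply: ler_sum => k _.
rewrite NE -(tau_devE z n1) /=.
have := class_tau_dev_le k z n1.
have Nn : 0 <= N k z / n%:R by rewrite divr_ge0// sumr_ge0.
have := cond_pair_prob_itv k; have := pair_prob_itv.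
move=> q0_itv q_itv h.
have ab : `|(2 * cond_pair_prob k - 1) - (2 * pair_prob - 1)| <= 2.
  by rewrite ler_norml; lra.
apply: le_trans (weighted_distB_le _ _ _ Nn ab) _.
rewrite -[leLHS]addrA -[leRHS]addrA -[leRHS]addrA; apply: lerD; first by [].
rewrite [leLHS]addrC [leRHS]addrCA; apply: lerD; [by []|exact: h].
Qed.

(* 28 = 2 * 2 + 12 + 12 is n times the sum of the three bounded-difference
   constants. *)
Lemma signed_comb_mgf s s' (r : {ffun 'I_1 -> bool}) (l : R) :
  (0 < n)%N -> 0 <= l ->
  Ex mu (fun z => expR (l * (2 * signed_sum A s z + signed_sum B s' z +
                             signed_sum C r z))) <=
  expR (2 * 28 ^+ 2 * l ^+ 2 / n%:R).
Proof.
move=> n0 l0; have n0' : 0 < n%:R :> R by rewrite ltr0n.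
have Ad : bounded_diff (I := 'I_n) (2 * (1 / n%:R)) (signed_sum A s).
  apply: (signed_sum_bounded_diff (y := y) (G := class_dev_loo mu y)).
    by move=> i k z; exact: class_dev_leave_one_out.
  by move=> i k z u; rewrite /class_dev_loo class_size_upd.
have Bd : bounded_diff (I := 'I_n) (2 * (6 / n%:R)) (signed_sum B s').
  apply: (signed_sum_bounded_diff
    (y := y) (G := fun i => pair_stat y class_kernel (predC1 i))).
    by move=> i k z; exact: (pair_stat_leave_one_out class_kernel_le).
  by move=> i k z u; exact: pair_stat_upd.
have Cd : bounded_diff (I := 'I_n) (2 * (6 / n%:R)) (signed_sum C r).
  apply: (signed_sum_bounded_diff
    (y := one_class) (G := fun i => pair_stat one_class kernel (predC1 i))).
    by move=> i k z; exact: (pair_stat_leave_one_out kernel_le).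
  by move=> i k z u; exact: pair_stat_upd.
have := bounded_diffZ l0 (bounded_diffD (bounded_diffD
  (bounded_diffZ (ler0n R 2) Ad) Bd) Cd).
move=> /(mcdiarmid mu_ge0 mu_sum1); rewrite card_ord => H.
apply: (le_trans (H _)).
  rewrite ExZ !ExD ExZ !Ex_signed_sum ?mulr0 ?addr0 ?mulr0// => k.
  - exact: (Ex_pair_stat mu_sum1 kernel_le kernel_mean0).
  - exact: (Ex_pair_stat mu_sum1 class_kernel_le class_kernel_mean0).
  - exact: Ex_class_dev.
rewrite ler_expR le_eqVlt; apply/orP; left; apply/eqP.
by field; lra.
Qed.

(* For each outcome some choice of signs turns the three sums of absolute values
   into signed sums; the factor [2 * 4 ^+ K] counts these choices. *)
Lemma score_tail (t : R) : (1 < n)%N -> 0 < t -> 2 * K%:R / n%:R <= t / 2 ->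
  Ex mu (fun z : {ffun 'I_n -> Z} =>
    (t < `|kif_score (fun i t => g (z i) (z t)) (fun i => y (z i)) -
           kif_pop class_prob cond_pair_prob pair_prob|)%R%:R) <=
  2 * 4 ^+ K * expR (- (n%:R * t ^+ 2 / (32 * 28 ^+ 2))).
Proof.
move=> n1 t0 Kn; have n1' : 2 <= n%:R :> R by rewrite ler_nat.
(* Minimises the exponent [- l t / 2 + 2 * 28^2 l^2 / n]. *)
pose l := n%:R * t / (8 * 28 ^+ 2).
have l0 : 0 <= l by rewrite /l; nra.
pose F (p : {ffun 'I_K -> bool} * {ffun 'I_K -> bool} * {ffun 'I_1 -> bool}) z :=
  2 * signed_sum A p.1.1 z + signed_sum B p.1.2 z + signed_sum C p.2 z.
apply: (@le_trans _ _ (Ex mu (fun z : {ffun 'I_n -> Z} =>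
   \sum_p expR (- (l * (t / 2))) * expR (l * F p z)))).
  apply: Ex_le => // z; case: ltP => [tz|_] /=; last first.
    by apply: sumr_ge0 => p _; rewrite mulr_ge0 ?expR_ge0.
  have [s Es] := sum_norm_signed A z; have [s' Es'] := sum_norm_signed B z.
  have [r Er] := sum_norm_signed C z.
  rewrite (bigD1 (s, s', r))//= -[leLHS]addr0; apply: lerD; last first.
    by apply: sumr_ge0 => p _; rewrite mulr_ge0 ?expR_ge0.
  (* The bound on [K] takes at most [t / 2] of the deviation, so the signed sum for these signs is
     at least [t / 2] and its term at least 1. *)
  rewrite -expRD -[leLHS]expR0 ler_expR /F/= -Es -Es' -Er.
  have := score_dev_le z n1; nra.
rewrite Ex_sum; apply: (@le_trans _ _ (\sum_(p : {ffun 'I_K -> bool} *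
    {ffun 'I_K -> bool} * {ffun 'I_1 -> bool})
    expR (- (n%:R * t ^+ 2 / (32 * 28 ^+ 2))))).
  apply: ler_sum => p _; rewrite ExZ.
  apply: le_trans (ler_wpM2l (expR_ge0 _) (signed_comb_mgf _ _ _ _ _)) _ => //.
    exact: ltnW.
  rewrite -expRD ler_expR le_eqVlt; apply/orP; left; apply/eqP.
  by rewrite /l; field; lra.
rewrite sumr_const !card_prod !card_ffun !card_ord card_bool -[leLHS]mulr_natl.
rewrite !natrM !natrX expr1 -exprMn (_ : 2 * 2 = 4 :> R); last by ring.
by rewrite [_ * 2]mulrC.
Qed.

End FiniteTail.

Local Open Scope classical_set_scope.
Local Open Scope ring_scope.

(** * Finite-valued maps and discretisation *)

Section FiniteValued.
Context {d : measure_display} {T : measurableType d}.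

(** Stated on fibres, so that codes and tables with finitely many values need no sigma-algebra on
    their type. *)
Definition fin_measurable (F : Type) (h : T -> F) :=
  forall a, measurable (h @^-1` [set a]).

Lemma fin_measurable_preimage (F : finType) (h : T -> F) (A : set F) :
  fin_measurable h -> measurable (h @^-1` A).
Proof.
move=> hm; rewrite (_ : h @^-1` A = \bigcup_(a in A) h @^-1` [set a]).
  by apply: fin_bigcup_measurable; first exact: finite_finset.
apply/seteqP; split => [x Ax|x [a Aa /= ->]//].
by exists (h x).
Qed.

Lemma fin_measurable_pair (F G : finType) (h : T -> F) (h' : T -> G) :
  fin_measurable h -> fin_measurable h' -> fin_measurable (fun x => (h x, h' x)).
Proof.
move=> hm hm' [a b]; rewrite (_ : _ @^-1` _ =
  (h @^-1` [set a]) `&` (h' @^-1` [set b])); first exact: measurableI.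
by apply/seteqP; split => x /= [-> ->].
Qed.

Lemma fin_measurable_ffun (I F : finType) (h : I -> T -> F) :
  (forall i, fin_measurable (h i)) -> fin_measurable (fun x => [ffun i => h i x]).
Proof.
move=> hm a; rewrite (_ : _ @^-1` _ =
    \bigcap_(i in setT) (h i @^-1` [set a i])).
  apply: fin_bigcap_measurable; first exact: finite_finset.
  by move=> i _; exact: hm.
apply/seteqP; split => [x /= <- i _|x H] /=; first by rewrite ffunE.
by apply/ffunP => i; rewrite ffunE; exact: H.
Qed.

Context {R : realType}.

Lemma fin_measurable_lt (f g : T -> R) : measurable_fun setT f ->
  measurable_fun setT g -> fin_measurable (fun x => f x < g x).
Proof.
move=> mf mg b.
rewrite -[X in measurable X]setTI.
exact: (measurable_realfun.measurable_fun_ltr mf mg measurableT).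
Qed.

Variable P : probability T R.

Definition pr (A : set T) : R := fine (P A).

Lemma prE A : measurable A -> P A = (pr A)%:E.
Proof. by move=> mA; rewrite /pr fineK// fin_num_measure. Qed.

Lemma pr_le A B : measurable A -> measurable B -> A `<=` B -> pr A <= pr B.
Proof.
by move=> mA mB AB; rewrite -lee_fin -!prE// le_measure// inE.
Qed.

Lemma prU_le A B : measurable A -> measurable B ->
  pr (A `|` B) <= pr A + pr B.
Proof.
move=> mA mB; rewrite -lee_fin EFinD -!prE//; last exact: measurableU.
by apply: (le_trans (measureU2 _ _ _)).
Qed.

Lemma pr_bigcup_le (I : finType) (Q : pred I) (A : I -> set T) :
  (forall i, measurable (A i)) ->
  pr [set x | exists2 i, Q i & A i x] <= \sum_(i | Q i) pr (A i).
Proof.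
move=> mA.
have -> : [set x | exists2 i, Q i & A i x] = \big[setU/set0]_(i | Q i) A i.
  by rewrite -bigcup_pred; apply/seteqP; split => x [i Qi Ax]; exists i.
have : measurable (\big[setU/set0]_(i | Q i) A i) /\
    pr (\big[setU/set0]_(i | Q i) A i) <= \sum_(i | Q i) pr (A i).
  elim/big_rec2: _ => [|i b B _ [mB IH]]; first by rewrite /pr measure0.
  split; first exact: measurableU.
  by apply: le_trans (prU_le _ _) _ => //; rewrite lerD2l.
by case.
Qed.

Lemma pr_fin_sum (F : finType) (h : T -> F) (A : pred F) : fin_measurable h ->
  pr [set x | A (h x)] = \sum_(a | A a) pr (h @^-1` [set a]).
Proof.
move=> hm; rewrite {1}/pr.
rewrite (_ : [set x | A (h x)] = \bigcup_(a in [set` enum A]) h @^-1` [set a]).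
  rewrite measure_fin_bigcup//; last first.
    by move=> a b _ _ [x [/= <- <-]].
  rewrite -fsbig_seq ?enum_uniq// -sum_fine; last first.
    by move=> a _; rewrite fin_num_measure.
  by rewrite big_enum.
apply/seteqP; split => [x Ax|x [a /= + ->]].
  by exists (h x) => //=; rewrite mem_enum.
by rewrite mem_enum.
Qed.

(** The symmetric difference lies outside [G]. *)
Lemma pr_dist_le A B G : measurable A -> measurable B -> measurable G ->
  (forall x, G x -> A x <-> B x) -> `|pr A - pr B| <= pr (~` G).
Proof.
move=> mA mB mG AB.
have key (C D : set T) : measurable C -> measurable D ->
    (forall x, G x -> C x -> D x) -> pr C <= pr D + pr (~` G).
  move=> mC mD CD; apply: le_trans (prU_le _ _) => //; last exact: measurableC.
  apply: pr_le => //; first by apply: measurableU => //; exact: measurableC.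
  by move=> x Cx; have [Gx|Gx] := pselect (G x); [left; apply: CD|right].
have := key _ _ mA mB (fun x Gx => (AB x Gx).1).
have := key _ _ mB mA (fun x Gx => (AB x Gx).2).
by rewrite ler_norml; lra.
Qed.

End FiniteValued.

Section Discretisation.
Context {R : realType}.

(* [cut] enumerates the rationals, with 0 at the indices coding none. *)
Definition cut (s : nat) : R := ratr (odflt 0 (unpickle s : option rat)).

Definition discr m (x : R) : {ffun 'I_m -> bool} := [ffun s : 'I_m => cut s < x].

(** Some threshold separates the two values. This never reports a false strict inequality; a true
    one is detected once [m] reaches a rational between the values. *)
Definition discr_lt m (a b : {ffun 'I_m -> bool}) := [exists s, ~~ a s && b s].

Lemma discr_ltE m x x' : reflect (exists2 s, (s < m)%N & x <= cut s < x')
  (discr_lt (discr m x) (discr m x')).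
Proof.
apply: (iffP existsP) => [[s]|[s sm xs]].
  by rewrite !ffunE -leNgt => xs; exists s.
by exists (Ordinal sm); rewrite !ffunE -leNgt.
Qed.

Lemma discr_ltW m x x' : discr_lt (discr m x) (discr m x') -> x < x'.
Proof. by move=> /discr_ltE[s _ /andP[]]; exact: le_lt_trans. Qed.

Lemma lt_discr_lt x x' : x < x' ->
  exists m0, forall m, (m0 <= m)%N -> discr_lt (discr m x) (discr m x').
Proof.
move=> /rat_in_itvoo[q]; rewrite in_itv /= => /andP[xq qx'].
exists (pickle q).+1 => m qm; apply/discr_ltE; exists (pickle q) => //.
by rewrite /cut pickleK /= ltW.
Qed.

Context {d : measure_display} {T : measurableType d}.

Lemma fin_measurable_discr m (f : T -> R) : measurable_fun setT f ->
  fin_measurable (fun x => discr m (f x)).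
Proof.
move=> mf; apply: (fin_measurable_ffun (h := fun (s : 'I_m) x => cut s < f x)) => s.
exact: fin_measurable_lt.
Qed.

Lemma measurable_discr_preimage m (a : {ffun 'I_m -> bool}) :
  measurable [set x : R | discr m x = a].
Proof.
have H := @fin_measurable_ffun _ R 'I_m bool (fun (s : 'I_m) x => cut s < x).
apply: H => s; apply: fin_measurable_lt => //.
Qed.

Variables (P : probability T R) (A : finType) (xi : A -> T -> R).
Hypothesis mxi : forall a, measurable_fun setT (xi a).

Definition agree m : set T := [set x | forall a b,
  discr_lt (discr m (xi a x)) (discr m (xi b x)) = (xi a x < xi b x)].

Lemma measurable_agree m : measurable (agree m).
Proof.
pose h x := ([ffun a => discr m (xi a x)],
             [ffun ab : A * A => xi ab.1 x < xi ab.2 x]).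
have hm : fin_measurable h.
  apply: fin_measurable_pair.
    by apply: fin_measurable_ffun => a; exact: fin_measurable_discr.
  apply: (fin_measurable_ffun (h := fun (ab : A * A) x => xi ab.1 x < xi ab.2 x)).
  by move=> ab; exact: fin_measurable_lt.
rewrite (_ : agree m = h @^-1` [set p : {ffun A -> {ffun 'I_m -> bool}} *
    {ffun A * A -> bool} | forall a b : A,
    discr_lt (p.1 a) (p.1 b) = p.2 (a, b)]).
  exact: fin_measurable_preimage.
by apply/seteqP; split => x H a b; have := H a b; rewrite /= !ffunE.
Qed.

(** At a given outcome there are finitely many comparisons, each decided correctly from some level
    on. *)
Lemma agree_cover : \bigcup_m agree m = setT.
Proof.
apply/seteqP; split => // x _.
have [m mP] : exists m, forall ab : A * A, xi ab.1 x < xi ab.2 x ->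
    discr_lt (discr m (xi ab.1 x)) (discr m (xi ab.2 x)).
  have : \forall m \near \oo, forall ab : A * A, xi ab.1 x < xi ab.2 x ->
      discr_lt (discr m (xi ab.1 x)) (discr m (xi ab.2 x)).
    apply: filter_forall => ab.
    have [/lt_discr_lt[m0 m0P]|ge] := ltP (xi ab.1 x) (xi ab.2 x).
      by exists m0 => // m /= mm _; exact: m0P.
    by near=> m.
  by case=> m _ mP; exists m => ab; apply: mP => /=.
exists m => // a b; apply/idP/idP; first exact: discr_ltW.
exact: (mP (a, b)).
Unshelve. all: by end_near. Qed.

Lemma agree_homo m m' : (m <= m')%N -> agree m `<=` agree m'.
Proof.
move=> mm' x H a b; apply/idP/idP; first exact: discr_ltW.
rewrite -H => /discr_ltE[s sm xs]; apply/discr_ltE; exists s => //.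
exact: leq_trans mm'.
Qed.

(** Continuity from below along the increasing events [agree m]. *)
Lemma agree_approx (delta : R) : 0 < delta -> exists m, pr P (~` agree m) <= delta.
Proof.
move=> delta0.
have cv : P (agree m) @[m --> \oo] --> (1%:E : \bar R).
  rewrite -(probability_setT P) -agree_cover.
  apply: nondecreasing_cvg_mu.
  - exact: measurable_agree.
  - by rewrite agree_cover.
  - by move=> m m' mm'; apply/subsetPset; exact: agree_homo.
have := cv; move=> /fine_cvgP[_] /cvgrPdist_le /(_ _ delta0)[m _ mP].
exists m; have := mP m (leqnn m) => /=.
rewrite /pr probability_setC; last exact: measurable_agree.
rewrite (prE P (measurable_agree m)) /= => H.
exact: le_trans (ler_norm _) H.
Qed.

End Discretisation.

(** * Transfer to the sample of the theorem *)

(** Concordance depends on order comparisons alone, which is what the discretisation can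
    preserve. *)
Lemma concE (R : realType) (a a' b b' : R) :
  conc a a' b b' = ((a' < a) && (b' < b)) || ((a < a') && (b < b')).
Proof.
rewrite /conc; case: (ltgtP a a') => [aa'|aa'|->] /=; last by rewrite subrr mul0r ltxx.
- by rewrite nmulr_rgt0 ?subr_lt0.
- by rewrite pmulr_rgt0 ?subr_gt0// orbF.
Qed.

Section Transfer.
Context {R : realType} {d : measure_display} {T : measurableType d}.
Variables (P : probability T R) (n p K : nat).
Variables (X0 X1 : 'I_p -> T -> R) (Y0 Y1 : T -> 'I_K).
Variables (X : 'I_n -> 'I_p -> T -> R) (Y : 'I_n -> T -> 'I_K).
Hypothesis copies : indep_copies P X0 Y0 X1 Y1.
Hypothesis sample : iid_sample P X Y X0 Y0.
Variables j l : 'I_p.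

Section Level.
Variable m : nat.

Local Notation code_type := ({ffun 'I_m -> bool} * {ffun 'I_m -> bool} * 'I_K)%type.

Definition code (x : 'I_p -> T -> R) (y : T -> 'I_K) (w : T) : code_type :=
  (discr m (x j w), discr m (x l w), y w).

(** Writes a fibre of [code] as a rectangle, the shape of event for which independence and equality
    of laws are assumed. Intersecting the two constraints also handles [j = l]. *)
Definition cell (z : code_type) (a : 'I_p) : set R :=
  (if a == j then [set x | discr m x = z.1.1] else setT) `&`
  (if a == l then [set x | discr m x = z.1.2] else setT).

Lemma measurable_cell z a : measurable (cell z a).
Proof.
by apply: measurableI; case: ifP => // _; exact: measurable_discr_preimage.
Qed.

Lemma rect_event_cell x y z :
  rect_event x y (cell z) [set z.2]%SET = code x y @^-1` [set z].
Proof.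
case: z => -[a b] k; rewrite /rect_event /cell /code /=.
apply/seteqP; split => [w /= [H]|w /= [ja lb yk]].
  rewrite inE => /eqP ->.
  have := H j; rewrite eqxx => -[/= -> _].
  by have := H l; rewrite eqxx => -[_ /= ->].
split; last by rewrite inE yk.
by move=> i; split; case: eqP => //= ->.
Qed.

Lemma fin_measurable_code x y : rv_pair x y -> fin_measurable (code x y).
Proof.
move=> [mx my]; apply: fin_measurable_pair; last exact: my.
by apply: fin_measurable_pair; exact: fin_measurable_discr.
Qed.

Definition cell_prob (z : code_type) : R := pr P (code X0 Y0 @^-1` [set z]).

Lemma rv_pair0 : rv_pair X0 Y0. Proof. by case: copies. Qed.
Lemma rv_pair1 : rv_pair X1 Y1. Proof. by case: copies => _ []. Qed.
Lemma rv_pair_sample i : rv_pair (X i) (Y i). Proof. by case: sample. Qed.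

Lemma cell_prob_ge0 z : 0 <= cell_prob z.
Proof. by rewrite fine_ge0. Qed.

Lemma cell_prob_sum1 : \sum_z cell_prob z = 1.
Proof.
have := pr_fin_sum P (xpredT) (fin_measurable_code rv_pair0).
rewrite /cell_prob => <-.
by rewrite (_ : [set _ | _] = setT) /pr ?probability_setT//; apply/seteqP.
Qed.

Lemma same_law_code x y z : rv_pair x y -> same_law P x y X0 Y0 ->
  P (rect_event x y (cell z) [set z.2]%SET) = (cell_prob z)%:E.
Proof.
move=> rxy ->; last by move=> a; exact: measurable_cell.
by rewrite rect_event_cell -prE//; exact: fin_measurable_code rv_pair0 _.
Qed.

Definition sample_code (w : T) : {ffun 'I_n -> code_type} :=
  [ffun i => code (X i) (Y i) w].

Lemma fin_measurable_sample_code : fin_measurable sample_code.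
Proof.
by apply: fin_measurable_ffun => i; exact: fin_measurable_code (rv_pair_sample i).
Qed.

(** A fibre of [sample_code] is an intersection of rectangles, so the i.i.d. hypothesis gives it the
    product weight of [Ex]. *)
Lemma pr_sample_code (Q : pred {ffun 'I_n -> code_type}) :
  pr P [set w | Q (sample_code w)] = Ex cell_prob (fun z => (Q z)%:R).
Proof.
rewrite (pr_fin_sum P Q fin_measurable_sample_code) big_mkcond /=.
apply: eq_bigr => z _; case: (Q z); rewrite ?mulr0// mulr1.
have [_ [indep law]] := sample.
have := indep [set: 'I_n]%SET (fun i => cell (z i)) (fun i => [set (z i).2]%SET)
  (fun i a => measurable_cell (z i) a).
rewrite (_ : \bigcap_(i in _) _ = sample_code @^-1` [set z]); last first.
  apply/seteqP; split => [w H|w /= H i _].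
    apply/ffunP => i; rewrite ffunE.
    by have := H i (finset.in_setT i); rewrite rect_event_cell.
  by rewrite rect_event_cell /= -H ffunE.
rewrite /pr => ->.
rewrite (eq_bigr (fun i => (cell_prob (z i))%:E)); last first.
  by move=> i _; exact: (same_law_code _ (rv_pair_sample i) (law i)).
rewrite -(big_morph (@EFin R) (@EFinM R) (erefl 1%:E)) /=.
by apply: eq_bigl => i; rewrite finset.in_setT.
Qed.

Lemma pr_pair_code (Q : code_type -> code_type -> bool) :
  pr P [set w | Q (code X0 Y0 w) (code X1 Y1 w)] =
  \sum_u \sum_v cell_prob u * cell_prob v * (Q u v)%:R.
Proof.
have hm : fin_measurable (fun w => (code X0 Y0 w, code X1 Y1 w)).
  by apply: fin_measurable_pair; apply: fin_measurable_code;
    [exact: rv_pair0|exact: rv_pair1].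
rewrite (pr_fin_sum P (fun uv => Q uv.1 uv.2) hm) pair_bigA big_mkcond /=.
apply: eq_bigr => -[u v] _ /=; case: (Q u v); rewrite ?mulr0// mulr1.
have [_ [_ [law indep]]] := copies.
have := indep (cell u) (cell v) [set u.2]%SET [set v.2]%SET
  (measurable_cell u) (measurable_cell v).
rewrite -(law _ _ (measurable_cell v)) !same_law_code//; last exact: rv_pair0.
- rewrite !rect_event_cell => H; rewrite /pr.
  rewrite (_ : _ @^-1` _ = (code X0 Y0 @^-1` [set u]) `&` (code X1 Y1 @^-1` [set v])).
    by rewrite H.
  by apply/seteqP; split => w /= [-> ->].
- exact: rv_pair0.
Qed.

Definition code_conc (u v : code_type) : bool :=
  (discr_lt v.1.1 u.1.1 && discr_lt v.1.2 u.1.2) ||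
  (discr_lt u.1.1 v.1.1 && discr_lt u.1.2 v.1.2).

(** Gathers the sample and the population pair in one finite family, so that a single level [m]
    serves both. *)
Definition vars (a : ('I_n + bool) * bool) : T -> R :=
  let c := if a.2 then l else j in
  match a.1 with inl i => X i c | inr b => if b then X1 c else X0 c end.

Lemma measurable_vars a : measurable_fun setT (vars a).
Proof.
case: a => -[i|[]] c; rewrite /vars /=.
- by have [] := rv_pair_sample i.
- by have [] := rv_pair1.
- by have [] := rv_pair0.
Qed.

Lemma agree_conc_sample w i t : agree vars m w ->
  conc (X i j w) (X t j w) (X i l w) (X t l w) =
  code_conc (code (X i) (Y i) w) (code (X t) (Y t) w).
Proof.
move=> H; rewrite concE /code_conc /code /=.
have Hj a b := H (inl a, false) (inl b, false).
have Hl a b := H (inl a, true) (inl b, true).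
by rewrite /vars /= in Hj Hl; rewrite !Hj !Hl.
Qed.

Lemma agree_conc_pop w : agree vars m w ->
  conc (X0 j w) (X1 j w) (X0 l w) (X1 l w) =
  code_conc (code X0 Y0 w) (code X1 Y1 w).
Proof.
move=> H; rewrite concE /code_conc /code /=.
have Hj a b := H (inr a, false) (inr b, false).
have Hl a b := H (inr a, true) (inr b, true).
have := Hj true false; have := Hj false true.
have := Hl true false; have := Hl false true.
by rewrite /vars /= => -> -> -> ->.
Qed.

Local Notation delta := (pr P (~` agree vars m)).
Local Notation class := (fun z : code_type => z.2).

Lemma pi_popE k : pi_pop P Y0 k = class_prob cell_prob class k.
Proof.
rewrite /class_prob /cell_prob.
rewrite -(pr_fin_sum P (fun z => z.2 == k) (fin_measurable_code rv_pair0)).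
by rewrite /pi_pop /pr; congr (fine (P _)); apply/seteqP; split => w /= /eqP.
Qed.

Lemma same_class_probE k :
  fine (P [set w | Y0 w = k /\ Y1 w = k]) = class_prob cell_prob class k ^+ 2.
Proof.
rewrite sqr_class_probE -(pr_pair_code (fun u v => (u.2 == k) && (v.2 == k))).
rewrite /pr; congr (fine (P _)); apply/seteqP; split => w /=.
  by move=> [-> ->]; rewrite eqxx.
by move=> /andP[/eqP ? /eqP].
Qed.

Definition pop_table (w : T) :=
  ((X0 j w < X1 j w, X0 l w < X1 l w), (X1 j w < X0 j w, X1 l w < X0 l w),
   (Y0 w, Y1 w)).

Lemma fin_measurable_pop_table : fin_measurable pop_table.
Proof.
have [m0 my0] := rv_pair0; have [m1 my1] := rv_pair1.
by repeat apply: fin_measurable_pair; try exact: fin_measurable_lt.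
Qed.

Lemma tau_prob_approx :
  `|pr P [set w | conc (X0 j w) (X1 j w) (X0 l w) (X1 l w)] -
    pair_prob cell_prob code_conc| <= delta.
Proof.
rewrite /pair_prob -pr_pair_code; apply: pr_dist_le.
- rewrite (_ : [set w | _] = pop_table @^-1` [set s |
    s.1.2.1 && s.1.2.2 || s.1.1.1 && s.1.1.2]).
    exact: fin_measurable_preimage fin_measurable_pop_table.
  by apply/seteqP; split => w /=; rewrite concE.
- have hm := fin_measurable_pair (fin_measurable_code rv_pair0)
    (fin_measurable_code rv_pair1).
  exact: (fin_measurable_preimage [set s | code_conc s.1 s.2] hm).
- exact/measurable_agree/measurable_vars.
- by move=> w /agree_conc_pop /= ->.
Qed.

Lemma class_tau_prob_approx k :
  `|pr P [set w | conc (X0 j w) (X1 j w) (X0 l w) (X1 l w) /\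
                  Y0 w = k /\ Y1 w = k] -
    class_pair_prob cell_prob class code_conc k| <= delta.
Proof.
rewrite /class_pair_prob.
rewrite -(pr_pair_code (fun u v => [&& code_conc u v, u.2 == k & v.2 == k])).
apply: pr_dist_le.
- rewrite (_ : [set w | _] = pop_table @^-1` [set s |
    (s.1.2.1 && s.1.2.2 || s.1.1.1 && s.1.1.2) /\ s.2.1 = k /\ s.2.2 = k]).
    exact: fin_measurable_preimage fin_measurable_pop_table.
  by apply/seteqP; split => w /=; rewrite concE.
- have hm := fin_measurable_pair (fin_measurable_code rv_pair0)
    (fin_measurable_code rv_pair1).
  exact: (fin_measurable_preimage [set s |
    [&& code_conc s.1 s.2, s.1.2 == k & s.2.2 == k]] hm).
- exact/measurable_agree/measurable_vars.
- move=> w /agree_conc_pop /= ->; split => [[-> [-> ->]]|]; first by rewrite !eqxx.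
  by move=> /and3P[-> /eqP ? /eqP].
Qed.

(** Conditioning divides the error by [pk ^+ 2] and the weight restores one factor [pk]. The
    remaining inverse probabilities are harmless, as [delta] can be made arbitrarily small at fixed
    [n]. *)
Lemma w_pop_approx :
  `|w_pop P X0 Y0 X1 Y1 j l - kif_pop (class_prob cell_prob class)
     (cond_pair_prob cell_prob class code_conc) (pair_prob cell_prob code_conc)|
  <= 2 * delta * (1 + \sum_k (pi_pop P Y0 k)^-1).
Proof.
have sum1 : \sum_k class_prob cell_prob class k = 1.
  rewrite /class_prob -cell_prob_sum1 (partition_big class xpredT)//=.
have -> : 2 * delta * (1 + \sum_k (pi_pop P Y0 k)^-1) =
    \sum_k (2 * delta * (class_prob cell_prob class k + (pi_pop P Y0 k)^-1)).
  by rewrite -mulr_sumr big_split /= sum1.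
rewrite /w_pop /kif_pop -sumrB.
apply: le_trans (ler_norm_sum _ _ _) _; apply: ler_sum => k _.
rewrite /tau_k_pop /tau_pop pi_popE same_class_probE /cond_pair_prob.
set pk := class_prob _ _ _.
have pk0 : 0 <= pk by apply: class_prob_ge0; exact: cell_prob_ge0.
have := class_tau_prob_approx k; have := tau_prob_approx; rewrite /pr.
set a := fine (P [set w | conc _ _ _ _]); set ak := fine (P [set w | conc _ _ _ _ /\ _]).
set dl := fine (P (~` _)).
set q := pair_prob _ _; set qk := class_pair_prob _ _ _ _ => aq akqk.
rewrite -mulrBr normrM (ger0_norm pk0).
apply: le_trans (ler_wpM2l pk0 (ler_dist_dist _ _)) _.
rewrite [X in `|X|](_ : _ = 2 * (ak - qk) / pk ^+ 2 - 2 * (a - q)); last by ring.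
apply: le_trans (ler_wpM2l pk0 (ler_normB _ _)) _.
rewrite [leLHS]mulrDr addrC [leRHS]mulrDr; apply: lerD.
  by rewrite normrM [`|2|]ger0_norm//; have := ler_wpM2l pk0 aq; lra.
rewrite !normrM [`|2|]ger0_norm// [`|_^-1|]ger0_norm ?invr_ge0 ?sqr_ge0//.
have [->|pkn0] := eqVneq pk 0; first by rewrite mul0r invr0 mulr0.
have -> : pk * (2 * `|ak - qk| / pk ^+ 2) = 2 * `|ak - qk| / pk by field.
by rewrite ler_wpM2r ?invr_ge0//; lra.
Qed.

End Level.

Definition sample_table (w : T) :=
  ([ffun it : 'I_n * 'I_n => (X it.1 j w < X it.2 j w, X it.1 l w < X it.2 l w)],
   [ffun i => Y i w]).

Lemma fin_measurable_sample_table : fin_measurable sample_table.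
Proof.
apply: fin_measurable_pair.
  apply: (fin_measurable_ffun (h := fun (it : 'I_n * 'I_n) w =>
    (X it.1 j w < X it.2 j w, X it.1 l w < X it.2 l w))) => it.
  have [[mi _] [mt _]] := (rv_pair_sample it.1, rv_pair_sample it.2).
  by apply: fin_measurable_pair; exact: fin_measurable_lt.
by apply: fin_measurable_ffun => i; have [] := rv_pair_sample i.
Qed.

Lemma w_hatE w : w_hat X Y j l w =
  kif_score (fun i t => conc (X i j w) (X t j w) (X i l w) (X t l w))
    (fun i => Y i w).
Proof.
have nkE k : n_k Y k w = #|[set i | Y i w == k]%SET|.
  by apply: eq_card => i; rewrite finset.inE; apply/idP/idP; rewrite inE.
rewrite /w_hat /kif_score; apply: eq_bigr => k _.
by rewrite /pi_hat /tau_k_hat /tau_hat nkE.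
Qed.

Lemma measurable_w_hat (A : set R) : measurable [set w | A (w_hat X Y j l w)].
Proof.
pose sc (s : {ffun 'I_n * 'I_n -> bool * bool} * {ffun 'I_n -> 'I_K}) : R :=
  kif_score (fun i t => ((s.1 (t, i)).1 && (s.1 (t, i)).2) ||
    ((s.1 (i, t)).1 && (s.1 (i, t)).2)) s.2.
rewrite (_ : [set w | _] = sample_table @^-1` [set s | A (sc s)]).
  exact: fin_measurable_preimage fin_measurable_sample_table.
have E w : w_hat X Y j l w = sc (sample_table w).
  rewrite w_hatE /sc; congr kif_score; apply/funext => i /=; last by rewrite ffunE.
  by apply/funext => t; rewrite !ffunE concE.
by apply/seteqP; split => w /=; rewrite E.
Qed.

(** [score_tail] is uniform in the finite type of codes, so the level [m] may be chosen last. It is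
    applied at [t / 2], the other half being left to the error on [w_pop]; hence [128 = 4 * 32]. *)
Lemma kif_tail (t : R) : (1 < n)%N -> 0 < t -> 2 * K%:R / n%:R <= t / 4 ->
  pr P [set w | t < `|w_hat X Y j l w - w_pop P X0 Y0 X1 Y1 j l|] <=
  2 * 4 ^+ K * expR (- (n%:R * t ^+ 2 / (128 * 28 ^+ 2))).
Proof.
move=> n1 t0 Kn; apply/ler_addgt0Pr => e e0.
set S := 1 + \sum_k (pi_pop P Y0 k)^-1.
have S0 : 0 < S.
  rewrite ltr_pwDl// sumr_ge0// => k _; rewrite invr_ge0.
  by rewrite fine_ge0.
(* The bound [e] controls the event of disagreement; [t / (4 * S)] makes the bound of [w_pop_approx]
   at most [t / 2]. *)
have : 0 < Num.min e (t / (4 * S)).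
  by rewrite lt_min e0 divr_gt0// mulr_gt0.
move=> /(agree_approx P measurable_vars)[m].
rewrite le_min => /andP[me mt].
have mA : measurable (agree vars m) by exact/measurable_agree/measurable_vars.
have t2 : 0 < t / 2 by lra.
have Kn2 : 2 * K%:R / n%:R <= t / 2 / 2 by lra.
have := score_tail (fun z : {ffun 'I_m -> bool} * {ffun 'I_m -> bool} * 'I_K => z.2)
  (@code_conc m) (@cell_prob_ge0 m) (@cell_prob_sum1 m) n1 t2 Kn2.
set w' := kif_pop _ _ _.
have ww' : `|w_pop P X0 Y0 X1 Y1 j l - w'| <= t / 2.
  apply: le_trans (w_pop_approx m) _; rewrite -/S.
  move: mt; rewrite ler_pdivlMr ?mulr_gt0//; lra.
pose Q (z : {ffun 'I_n -> {ffun 'I_m -> bool} * {ffun 'I_m -> bool} * 'I_K}) :=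
  t / 2 < `|kif_score (fun i s => code_conc (z i) (z s)) (fun i => (z i).2) - w'|.
rewrite -(pr_sample_code Q) => tail.
have mQ : measurable [set w | Q (sample_code m w)].
  exact: (fin_measurable_preimage [set z | Q z] (@fin_measurable_sample_code m)).
apply: le_trans (_ : _ <= pr P ([set w | Q (sample_code m w)] `|` ~` agree vars m)) _.
  apply: pr_le; first exact: (measurable_w_hat [set v | t < `|v - w_pop P X0 Y0 X1 Y1 j l|]).
    by apply: measurableU => //; exact: measurableC.
  move=> w /= tw; rewrite /Q; have [Aw|] := pselect (agree vars m w); [left|by right].
  have <- : w_hat X Y j l w = kif_score
      (fun i s => code_conc (sample_code m w i) (sample_code m w s))
      (fun i => (sample_code m w i).2).
    rewrite w_hatE; congr kif_score; apply/funext => i; last by rewrite ffunE.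
    by apply/funext => s; rewrite !ffunE (agree_conc_sample i s Aw).
  have := ler_normD (w_hat X Y j l w - w') (w' - w_pop P X0 Y0 X1 Y1 j l).
  rewrite addrA subrK [`|w' - _|]distrC; lra.
apply: le_trans (prU_le _ mQ (measurableC mA)) _.
apply: lerD => //; apply: (le_trans tail).
rewrite le_eqVlt; apply/orP; left; apply/eqP; congr (_ * expR _).
by field.
Qed.

End Transfer.

(** * Rates in the sample size, union bound and conclusion *)

Lemma powR_dominated (R : realType) (A B a b : R) : 0 < B -> a < b ->
  exists N, forall n, (N <= n)%N -> A * n%:R `^ a <= B * n%:R `^ b.
Proof.
move=> B0 ab; pose s := b - a; have s0 : 0 < s by rewrite subr_gt0.
pose M := `|A| / B; have M0 : 0 <= M by rewrite divr_ge0// ltW.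
(* It suffices that [n ^ s >= M]. *)
exists (Num.bound (M `^ s^-1)).+1 => n nN.
have n0 : 0 < n%:R :> R by rewrite ltr0n (leq_trans _ nN).
have -> : b = a + s by rewrite /s; ring.
rewrite powRD; last by rewrite (gt_eqF n0) implybT.
rewrite mulrCA mulrC ler_wpM2l ?powR_ge0//.
apply: le_trans (ler_norm A) _; rewrite mulrC -ler_pdivrMr// -/M.
have -> : M = (M `^ s^-1) `^ s.
  by rewrite -powRrM mulVf ?lt0r_neq0// powRr1.
have le_n : M `^ s^-1 <= n%:R.
  apply/ltW/(lt_le_trans (archi_boundP (powR_ge0 _ _))).
  by rewrite ler_nat ltnW.
by apply: (ge0_ler_powR (ltW s0) _ _ le_n); rewrite nnegrE ?powR_ge0 ?ler0n.
Qed.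

Lemma pr_forall_ge (R : realType) (d : measure_display) (T : measurableType d)
    (P : probability T R) (I : finType) (Q : pred I) (E : I -> set T) (e : R) :
  (forall i, measurable (E i)) -> (forall i, Q i -> pr P (E i) <= e) ->
  ((1 - #|Q|%:R * e)%:E <= P [set w | forall i, Q i -> ~ E i w])%E.
Proof.
move=> mE Ee.
have -> : [set w | forall i, Q i -> ~ E i w] =
    ~` [set w | exists2 i, Q i & E i w].
  apply/seteqP; split => [w H [i Qi Ei]|w H i Qi Ei]; first exact: (H i).
  by apply: H; exists i.
have mU : measurable [set w | exists2 i, Q i & E i w].
  have -> : [set w | exists2 i, Q i & E i w] = \bigcup_(i in [set` Q]) E i.
    by apply/seteqP; split => w [i Qi Ei]; exists i.
  by apply: fin_bigcup_measurable; first exact: finite_finset.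
rewrite probability_setC// (prE P mU) -EFinB lee_fin lerD2l lerN2.
apply: le_trans (pr_bigcup_le P Q mE) _.
by rewrite mulr_natl -sumr_const; apply: ler_sum => i; exact: Ee.
Qed.

Lemma expr4_le_expR (R : realType) (K : nat) : 4 ^+ K <= expR (2 * K%:R) :> R.
Proof.
rewrite mulrC expRM_natl lerXn2r ?nnegrE ?expR_ge0//.
have h : 2 <= expR 1 :> R by have := expR_ge1Dx (1 : R); lra.
have -> : expR 2 = expR 1 * expR 1 :> R by rewrite -expRD.
by nra.
Qed.

(** The first bound on [K] is what [kif_tail] requires at [t = c n^(-r)]. The second lets
    [4^K <= exp (2 K)] use up half of the exponent, since [(16 * 28)^2 = 2 * 128 * 28^2]; the other
    half is more than the stated rate. *)
Lemma kif_tail_rate (R : realType) (c r d : R) (n p K : nat)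
    (dT : measure_display) (T : measurableType dT) (P : probability T R)
    (X0 X1 : 'I_p -> T -> R) (Y0 Y1 : T -> 'I_K)
    (X : 'I_n -> 'I_p -> T -> R) (Y : 'I_n -> T -> 'I_K) (j l : 'I_p) :
  indep_copies P X0 Y0 X1 Y1 -> iid_sample P X Y X0 Y0 ->
  (1 < n)%N -> 0 < c -> 0 <= d ->
  2 * K%:R <= c / 4 * n%:R `^ (1 - r) ->
  2 * K%:R <= c ^+ 2 / (16 * 28) ^+ 2 * n%:R `^ (1 - 2 * r) ->
  pr P [set w | c * n%:R `^ (- r) < `|w_hat X Y j l w - w_pop P X0 Y0 X1 Y1 j l|] <=
  2 * (n%:R `^ d *
    expR (- (c ^+ 2 * n%:R `^ (1 - 2 * (r + d))) / (72 * (16 * 28) ^+ 2))).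
Proof.
move=> copies sample n1 c0 d0 K1 K2.
have n1' : 1 <= n%:R :> R by rewrite ler1n ltnW.
have n0 : 0 < n%:R :> R by lra.
have pD (x y : R) : n%:R `^ (x + y) = n%:R `^ x * n%:R `^ y.
  by rewrite powRD// (gt_eqF n0) implybT.
have p1 : n%:R `^ 1 = n%:R :> R by rewrite powRr1// ltW.
have t0 : 0 < c * n%:R `^ (- r) by rewrite mulr_gt0// powR_gt0.
apply: le_trans (kif_tail copies sample j l n1 t0 _) _.
  rewrite ler_pdivrMr//; apply: (le_trans K1).
  by rewrite pD p1; lra.
have nd : 1 <= n%:R `^ d by rewrite -[leLHS](powRr0 (n%:R : R)) ler_powR.
rewrite -mulrA ler_pM2l//.
apply: le_trans (ler_wpM2r (expR_ge0 _) (expr4_le_expR R K)) _.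
rewrite -expRD; apply: le_trans (_ : _ <= 1 * _) (ler_wpM2r (expR_ge0 _) nd).
rewrite mul1r ler_expR.
have -> : n%:R * (c * n%:R `^ (- r)) ^+ 2 = c ^+ 2 * n%:R `^ (1 - 2 * r).
  rewrite (_ : 1 - 2 * r = 1 + (- r + - r)); last by ring.
  by rewrite !pD p1; ring.
have le : n%:R `^ (1 - 2 * (r + d)) <= n%:R `^ (1 - 2 * r).
  by apply: ler_powR => //; lra.
have Z0 : 0 <= n%:R `^ (1 - 2 * (r + d)) by exact: powR_ge0.
move: K2 le Z0; set V := n%:R `^ (1 - 2 * r); set W := _ `^ _ => K2 le Z0.
have := ler_wpM2l (sqr_ge0 c) le.
have : 0 <= c ^+ 2 * W by rewrite mulr_ge0 ?sqr_ge0.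
by lra.
Qed.

Theorem theorem1 (R : realType) (c c1 c2 : R) :
  0 < c -> 0 < c1 -> 0 < c2 ->
  exists b : R, 0 < b /\
  forall (r d : R) (p K : nat -> nat) (dT : measure_display)
    (Omega : nat -> measurableType dT) (P : forall n, probability (Omega n) R)
    (X0 X1 : forall n, 'I_(p n) -> Omega n -> R)
    (Y0 Y1 : forall n, Omega n -> 'I_(K n))
    (X : forall n, 'I_n -> 'I_(p n) -> Omega n -> R)
    (Y : forall n, 'I_n -> Omega n -> 'I_(K n))
    (S : forall n, {set 'I_(p n) * 'I_(p n)}),
    (* model: (X,Y) with independent copy (X~,Y~), and an i.i.d. sample of size n *)
    (forall n, indep_copies (P n) (X0 n) (Y0 n) (X1 n) (Y1 n)) ->
    (forall n, iid_sample (P n) (X n) (Y n) (X0 n) (Y0 n)) ->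
    0 <= r -> r < 1 / 2 -> 0 <= d -> d < 1 / 2 - r ->
    (* (C1) *)
    (exists N, forall n, (N <= n)%N -> forall k : 'I_(K n),
        c1 / (K n)%:R <= pi_pop (P n) (Y0 n) k <= c2 / (K n)%:R) ->
    (* (C2) *)
    (exists N, forall n, (N <= n)%N -> forall jl, jl \in S n ->
        2 * c * n%:R `^ (- r) <
        w_pop (P n) (X0 n) (Y0 n) (X1 n) (Y1 n) jl.1 jl.2) ->
    (* (C3) K = O(n^d) *)
    (exists C : R, exists N, forall n, (N <= n)%N -> (K n)%:R <= C * n%:R `^ d) ->
    (* (C4) log p = o(n^(1 - 2(r + d))) *)
    (forall eps : R, 0 < eps -> exists N, forall n, (N <= n)%N ->
        ln (p n)%:R <= eps * n%:R `^ (1 - 2 * (r + d))) ->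
    (* (i) *)
    (exists C : R, exists N, forall n, (N <= n)%N ->
       ((1 - C * ((p n)%:R ^+ 2 * n%:R `^ d *
           expR (- (c ^+ 2 * n%:R `^ (1 - 2 * (r + d))) / (72 * b ^+ 2))))%:E
        <= P n [set w | forall j l : 'I_(p n),
               (`|w_hat (X n) (Y n) j l w - w_pop (P n) (X0 n) (Y0 n) (X1 n) (Y1 n) j l|
               <= c * n%:R `^ (- r))%R])%E) /\
    (* (ii) *)
    (exists C : R, exists N, forall n, (N <= n)%N ->
       ((1 - C * ((#|S n|)%:R * n%:R `^ d *
           expR (- (c ^+ 2 * n%:R `^ (1 - 2 * (r + d))) / (72 * b ^+ 2))))%:E
        <= P n [set w | forall jl, jl \in S n ->
               (c * n%:R `^ (- r) < w_hat (X n) (Y n) jl.1 jl.2 w)%R])%E).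

Proof.
(* In [b], 28 comes from the bounded differences and [16^2 = 2 * 128] from halving the exponent of
   [kif_tail]. *)
move=> c0 c1_gt0 c2_gt0; exists (16 * 28); split; first lra.
move=> r d p K dT Omega P X0 X1 Y0 Y1 X Y S copies sample r0 r12 d0 d12.
move=> _ [N2 C2] [C [N3 C3]] _.
have B4 : 0 < c / 4 by lra.
have B5 : 0 < c ^+ 2 / (16 * 28) ^+ 2 by rewrite divr_gt0// exprn_gt0//; lra.
have d4 : d < 1 - r by lra.
have d5 : d < 1 - 2 * r by lra.
(* As [d] is below both [1 - r] and [1 - 2 r], the bound [2 C n^d] on [2 K] eventually meets both
   requirements of [kif_tail_rate]. *)
have [N4 H4] := @powR_dominated R (2 * C) _ _ _ B4 d4.
have [N5 H5] := @powR_dominated R (2 * C) _ _ _ B5 d5.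
pose N := maxn 2 (maxn N2 (maxn N3 (maxn N4 N5))).
have tail n j l : (N <= n)%N ->
    pr (P n) [set w | c * n%:R `^ (- r) < `|w_hat (X n) (Y n) j l w -
      w_pop (P n) (X0 n) (Y0 n) (X1 n) (Y1 n) j l|] <=
    2 * (n%:R `^ d *
      expR (- (c ^+ 2 * n%:R `^ (1 - 2 * (r + d))) / (72 * (16 * 28) ^+ 2))).
  rewrite !geq_max => /and5P[n1 nN2 nN3 nN4 nN5].
  apply: kif_tail_rate => //.
  - by have := C3 n nN3; have := H4 n nN4; lra.
  - by have := C3 n nN3; have := H5 n nN5; lra.
split; exists 2, N => n nN.
- have := @pr_forall_ge R _ _ (P n) _ xpredT (fun jl : 'I_(p n) * 'I_(p n) =>
    [set w | c * n%:R `^ (- r) < `|w_hat (X n) (Y n) jl.1 jl.2 w -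
      w_pop (P n) (X0 n) (Y0 n) (X1 n) (Y1 n) jl.1 jl.2|]) _ _
    (fun jl _ => tail n jl.1 jl.2 nN).
  rewrite (_ : [set w | forall i, _] = [set w | forall j l : 'I_(p n),
      `|w_hat (X n) (Y n) j l w - w_pop (P n) (X0 n) (Y0 n) (X1 n) (Y1 n) j l|
      <= c * n%:R `^ (- r)]); last first.
    apply/seteqP; split => [w H j l|w H [j l] _ /=].
      by have /= := H (j, l) isT; rewrite leNgt => /negP.
    by apply/negP; rewrite -leNgt.
  move=> H; apply: (le_trans _ (H _)).
    by rewrite lee_fin card_prod card_ord natrM; lra.
  move=> jl.
  exact: (measurable_w_hat (sample n) jl.1 jl.2 [set v | c * n%:R `^ (- r) <
    `|v - w_pop (P n) (X0 n) (Y0 n) (X1 n) (Y1 n) jl.1 jl.2|]).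
- pose E (jl : 'I_(p n) * 'I_(p n)) :=
    [set w | w_hat (X n) (Y n) jl.1 jl.2 w <= c * n%:R `^ (- r)].
  have mE jl : measurable (E jl).
    exact: (measurable_w_hat (sample n) jl.1 jl.2 [set v | v <= c * n%:R `^ (- r)]).
  (* On [S n] the population score exceeds [2 c n^(-r)], so missing a couple forces a deviation
     above [c n^(-r)]. The union runs over [S n] only. *)
  have Ee jl : jl \in S n -> pr (P n) (E jl) <= 2 * (n%:R `^ d *
      expR (- (c ^+ 2 * n%:R `^ (1 - 2 * (r + d))) / (72 * (16 * 28) ^+ 2))).
    move=> jlS; apply: le_trans (tail n jl.1 jl.2 nN); apply: pr_le => //.
      exact: (measurable_w_hat (sample n) jl.1 jl.2 [set v | c * n%:R `^ (- r) <
        `|v - w_pop (P n) (X0 n) (Y0 n) (X1 n) (Y1 n) jl.1 jl.2|]).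
    move=> w; rewrite /E /=.
    move: nN; rewrite !geq_max => /and5P[_ nN2 _ _ _].
    have := C2 n nN2 jl jlS; rewrite -mulrA.
    rewrite distrC; set W := w_pop _ _ _ _ _ _ _; set V := w_hat _ _ _ _ _.
    by move=> ? ?; apply: lt_le_trans (ler_norm _); lra.
  have := @pr_forall_ge R _ _ (P n) _ (mem (S n)) E _ mE Ee.
  rewrite (_ : [set w | forall i, _] = [set w | forall jl, jl \in S n ->
      c * n%:R `^ (- r) < w_hat (X n) (Y n) jl.1 jl.2 w]); last first.
    apply/seteqP; split => w H jl /H; rewrite /E /= ltNge; first by move/negP.
    by move=> /negP.
  by apply: le_trans; rewrite lee_fin; lra.
Qed.
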